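(* The exhaustive $\alpha$-decomposition algorithm (described in the context) finds an indecomposable decomposition: applied to an $\alpha$-decomposed presentation $[M_{\mathcal B}\ N]$ over a finite field $\mathbb F_q$, it returns a block-decomposed presentation of the same module in which every block presents an indecomposable module.
   Context: Let $\mathbb K=\mathbb F_q$ and $A=\mathbb K[x_1,\dots,x_d]$ with its $\mathbb Z^d$-grading; a persistence module is a finitely presented $\mathbb Z^d$-graded $A$-module. $\mathbb Z^d$ has the product order. For tuples of degrees $G:[m]\to\mathbb Z^d$, $R:[r]\to\mathbb Z^d$, a graded matrix $M\in\mathbb K^{G\times R}$ is an $m\times r$ matrix with $M_{i,j}=0$ unless $R(j)\ge G(i)$; it is the same as a graded map $A^R\to A^G$, $A^G=\bigoplus_iA(-G(i))$, and presents its cokernel. It is minimal if no presentation of the same module has fewer rows or columns. A block $b$ is a pair of a row index set and a column index set, with submatrix $M_b$ and row/column degrees $G_b,R_b$; $M$ is block-decomposed by a set $\mathcal B$ of blocks if the blocks partition the rows and the columns and $M$ vanishes outside the blocks; then we write $M_{\mathcal B}$. It is an indecomposable decomposition if each $M_b$ presents an indecomposable module. An $\alpha$-decomposed presentation is a minimal presentation $[M_{\mathcal B}\ N]$ where $N$ consists of $k$ columns of degree $\alpha$, $M_{\mathcal B}$ is an indecomposable decomposition, and no column of $M_{\mathcal B}$ has degree $\ge\alpha$. $N_b$ denotes the rows of $N$ belonging to $b$. BlockReduce$(b)$: decide whether there are a graded matrix $U\in\mathbb K^{R_b\times k\cdot\alpha}$ and, for every $c\neq b$ in $\mathcal B$,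 graded matrices $Q_c\in\mathbb K^{G_b\times G_c}$, $P_c\in\mathbb K^{R_b\times R_c}$ with $Q_cM_c+M_bP_c=0$ and $N_b+\sum_cQ_cN_c+M_bU=0$; if so, replace $N_b$ by $0$. $\mathrm{Dec}_q(k)$: a set of invertible matrices $[T_1\ T_2]\in\mathbb F_q^{k\times k}$ with $T_1$ having $l$ columns, $1\le l\le k/2$; for $l<k/2$ every $l$-dimensional subspace of $\mathbb F_q^k$ is the column space of exactly one $T_1$ (in column-echelon form), for $l=k/2$ only the subspaces whose pivot set contains the first position are used; $T_2$ is any complement, with opposite pivots. Exhaustive $\alpha$-decomposition. It is invoked after BlockReduce has been applied to each $N_b$, $b\in\mathcal B$, with all columns of $N$; blocks with $N_b=0$ are split off as finished and only the blocks with $N_b\neq0$ are passed on. On input $[M_{\mathcal B}\ N]$, for each $[T_1\ T_2]\in\mathrm{Dec}_q(k)$: (1) set $N_1=NT_1$, $N_2=NT_2$; (2) for each $b\in\mathcal B$ try to clear $(N_1)_b$ with BlockReduce (for $[M_{\mathcal B}\ N_1]$, operations also applied to $N_2$); (3) let $\mathcal B_1$ be the blocks with $(N_1)_b\neq0$ and $\mathcal B_2$ its complement; (4) try to clear $(N_2)_{\mathcal B_1}$ with BlockReduce, i.e. using column operations from $M_{\mathcal B_1}$, row operations from $\mathcal B_2$ to $\mathcal B_1$ that form morphisms of presentations $M_{\mathcal B_2}\to M_{\mathcal B_1}$, and additions of multiples of columns of $N_1$ to columns of $N_2$; (5) if successful, recursively treat $[M_{\mathcal B_1}\ N_1]$ and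 $[M_{\mathcal B_2}\ N_2]$ and return the resulting block-decomposition $\begin{bmatrix}M_{\mathcal B_1}&0&N_1&0\\0&M_{\mathcal B_2}&0&N_2\end{bmatrix}$. If no $[T_1\ T_2]$ succeeds, return $[M_{\mathcal B}\ N]$, considered as one block. *)

(* Defs.v *)
From HB Require Import structures.
From mathcomp Require Import all_boot all_order all_algebra.

Set Implicit Arguments.
Unset Strict Implicit.
Unset Printing Implicit Defensive.

Import Order.TTheory GRing.Theory Num.Theory.
Local Open Scope ring_scope.

Definition deg (d : nat) := {ffun 'I_d -> int}.

Definition ledeg d (z w : deg d) : bool := [forall i, z i <= w i].

Lemma ledeg_refl d (z : deg d) : ledeg z z.
Proof. by apply/forallP => i. Qed.

Lemma ledeg_trans d (x y z : deg d) : ledeg x y -> ledeg y z -> ledeg x z.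
Proof.
by move=> /forallP xy /forallP yz; apply/forallP => i; apply: le_trans (yz i).
Qed.

(* A Z^d-graded A-module is given by its homogeneous components and by the
   K-linear action of the monomials, which form a K-basis of A: for z <= w,
   [mon] is multiplication by x^(w - z), from degree z to degree w. *)
Record gmodule (K : fieldType) (d : nat) := GModule {
  comp :> deg d -> lmodType K;
  mon : forall z w, ledeg z w -> comp z -> comp w;
  mon_linear : forall z w (h : ledeg z w), linear (mon h);
  mon1 : forall z (h : ledeg z z) v, mon h v = v;
  monM : forall x y z (h : ledeg x y) (h' : ledeg y z) (h'' : ledeg x z) v,
    mon h' (mon h v) = mon h'' v
}.

Section GradedModules.

Variables (K : fieldType) (d : nat).
Implicit Types X Y : gmodule K d.

Definition gmiso X Y : Prop :=
  exists f : forall z, X z -> Y z,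
    [/\ forall z, linear (f z),
        forall z, bijective (f z)
      & forall z w (h : ledeg z w) v, f w (mon h v) = mon h (f z v)].

Definition gmzero X : Prop := forall z (v : X z), v = 0.

Section DirectSum.

Variables X Y : gmodule K d.

Definition dsum_mon z w (h : ledeg z w) (v : X z * Y z) : X w * Y w :=
  (mon h v.1, mon h v.2).

Lemma dsum_mon_linear z w (h : ledeg z w) : linear (dsum_mon h).
Proof. by move=> a u v; rewrite /dsum_mon /= !mon_linear. Qed.

Lemma dsum_mon1 z (h : ledeg z z) v : dsum_mon h v = v.
Proof. by case: v => u v; rewrite /dsum_mon !mon1. Qed.

Lemma dsum_monM x y z (h : ledeg x y) (h' : ledeg y z) (h'' : ledeg x z) v :
  dsum_mon h' (dsum_mon h v) = dsum_mon h'' v.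
Proof. by rewrite /dsum_mon /= !(monM h h' h''). Qed.

Definition dsum : gmodule K d :=
  @GModule K d (fun z => (X z * Y z)%type) dsum_mon dsum_mon_linear dsum_mon1
    dsum_monM.

End DirectSum.

Definition indecomposable X : Prop :=
  ~ gmzero X /\
  forall Y Z : gmodule K d, gmiso X (dsum Y Z) -> gmzero Y \/ gmzero Z.

End GradedModules.

Section VQuot.

Variables (K : fieldType) (V : vectType K) (W : {vspace V}).

Definition vquot := Quotient.quot (pred_of_vspace W).
HB.instance Definition _ := GRing.Zmodule.on vquot.

Definition vproj (v : V) : vquot := \pi_(Quotient.quot (pred_of_vspace W))%qT v.
Definition vrep (x : vquot) : V := repr (x : Quotient.quot (pred_of_vspace W)).

Lemma vrepK : cancel vrep vproj.
Proof. by move=> x; apply: reprK. Qed.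

Lemma vprojE u v : (vproj u = vproj v) <-> (u - v \in W).
Proof. by rewrite Quotient.idealrBE; split=> [/eqP|/eqP]. Qed.

Lemma vprojK v : vrep (vproj v) - v \in W.
Proof. by apply/vprojE; rewrite vrepK. Qed.

Lemma vprojD : {morph vproj : u v / u + v}.
Proof. by move=> u v; apply: (raddfD (\pi_(Quotient.quot (pred_of_vspace W))%qT)). Qed.

Definition vquot_scale (a : K) (x : vquot) : vquot := vproj (a *: vrep x).

Lemma vprojZ a v : vquot_scale a (vproj v) = vproj (a *: v).
Proof. by apply/vprojE; rewrite -scalerBr memvZ ?vprojK. Qed.

Fact vquot_scaleA a b x :
  vquot_scale a (vquot_scale b x) = vquot_scale (a * b) x.
Proof. by rewrite -[x]vrepK !vprojZ scalerA. Qed.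

Fact vquot_scale1 : left_id 1 vquot_scale.
Proof. by move=> x; rewrite -[x]vrepK vprojZ scale1r. Qed.

Fact vquot_scaleDr : right_distributive vquot_scale +%R.
Proof.
by move=> a x y; rewrite -[x]vrepK -[y]vrepK -vprojD !vprojZ scalerDr vprojD.
Qed.

Fact vquot_scaleDl x : {morph vquot_scale^~ x : a b / a + b}.
Proof. by move=> a b; rewrite -[x]vrepK !vprojZ scalerDl vprojD. Qed.

HB.instance Definition _ := GRing.Zmodule_isLmodule.Build K vquot
  vquot_scaleA vquot_scale1 vquot_scaleDr vquot_scaleDl.

Lemma vproj_linear : linear vproj.
Proof. by move=> a u v; rewrite vprojD -vprojZ. Qed.

End VQuot.

Section GradedMatrices.

Variables (K : fieldType) (d : nat).

Definition graded m r (G : 'I_m -> deg d) (R : 'I_r -> deg d)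
    (M : 'M[K]_(m, r)) : Prop :=
  forall i j, ~~ ledeg (G i) (R j) -> M i j = 0.

Section Cokernel.

Variables (m r : nat) (G : 'I_m -> deg d) (R : 'I_r -> deg d).
Variable M : 'M[K]_(m, r).

(* In degree z, the free module A^G has the basis x^(z - G i) e_i, where
   G i <= z; it is identified with a coordinate subspace of K^m. Then the
   monomials act by inclusions, and the image of A^R is spanned by the columns
   of M of degree at most z. *)
Definition gens z : {vspace 'cV[K]_m} :=
  (\sum_(i | ledeg (G i) z) <[delta_mx i ord0]>)%VS.

Definition rels z : {vspace 'cV[K]_m} :=
  (\sum_(j | ledeg (R j) z) <[col j M]>)%VS.

Definition grels z : {vspace subvs_of (gens z)} :=
  (linfun (vsval : subvs_of (gens z) -> 'cV[K]_m) @^-1: rels z)%VS.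

Definition coker_mon z w (h : ledeg z w) (x : vquot (grels z)) :
    vquot (grels w) :=
  vproj (grels w) (vsproj (gens w) (vsval (vrep x))).

Lemma gens_sub z w : ledeg z w -> (gens z <= gens w)%VS.
Proof.
move=> zw; apply/subv_sumP => i Gi; apply: (sumv_sup i) => //.
exact: ledeg_trans Gi zw.
Qed.

Lemma rels_sub z w : ledeg z w -> (rels z <= rels w)%VS.
Proof.
move=> zw; apply/subv_sumP => j Rj; apply: (sumv_sup j) => //.
exact: ledeg_trans Rj zw.
Qed.

Lemma mem_grels z v : (v \in grels z) = (vsval v \in rels z).
Proof. by rewrite -memv_preim lfunE. Qed.

Lemma coker_monE z w (h : ledeg z w) v :
  coker_mon h (vproj (grels z) v)
  = vproj (grels w) (vsproj (gens w) (vsval v)).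
Proof.
apply/vprojE; rewrite -linearB mem_grels vsprojK.
  rewrite -linearB (subvP (rels_sub h)) // -mem_grels; exact: vprojK.
by rewrite (subvP (gens_sub h)) // -linearB subvsP.
Qed.

Lemma coker_mon_linear z w (h : ledeg z w) : linear (coker_mon h).
Proof.
move=> a x y; rewrite -[x]vrepK -[y]vrepK -vproj_linear !coker_monE.
by rewrite !linearP /= vproj_linear.
Qed.

Lemma coker_mon1 z (h : ledeg z z) x : coker_mon h x = x.
Proof. by rewrite /coker_mon vsvalK vrepK. Qed.

Lemma coker_monM x y z (h : ledeg x y) (h' : ledeg y z) (h'' : ledeg x z) v :
  coker_mon h' (coker_mon h v) = coker_mon h'' v.
Proof.
rewrite -[v]vrepK !coker_monE vsprojK //.
by rewrite (subvP (gens_sub h)) // subvsP.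
Qed.

Definition coker : gmodule K d :=
  @GModule K d (fun z => vquot (grels z)) coker_mon coker_mon_linear
    coker_mon1 coker_monM.

End Cokernel.

Definition minimal m r (G : 'I_m -> deg d) (R : 'I_r -> deg d)
    (M : 'M[K]_(m, r)) : Prop :=
  forall m' r' (G' : 'I_m' -> deg d) (R' : 'I_r' -> deg d) (M' : 'M[K]_(m', r')),
    graded G' R' M' -> gmiso (coker G' R' M') (coker G R M) ->
    (m <= m')%N /\ (r <= r')%N.

End GradedMatrices.

(* Row index set and column index set. *)
Definition block (m r : nat) := ({set 'I_m} * {set 'I_r})%type.

Definition degs d m (S : {set 'I_m}) (G : 'I_m -> deg d) : 'I_#|S| -> deg d :=
  fun i => G (enum_val i).
Arguments degs {d m} S G.

Section Blocks.

Variables (K : fieldType) (m : nat).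

Definition rsub k (S : {set 'I_m}) (N : 'M[K]_(m, k)) : 'M[K]_(#|S|, k) :=
  rowsub (@enum_val _ (mem S)) N.

Definition submx r (b : block m r) (M : 'M[K]_(m, r)) : 'M[K]_(#|b.1|, #|b.2|) :=
  mxsub (@enum_val _ (mem b.1)) (@enum_val _ (mem b.2)) M.

Definition setrows k (S : {set 'I_m}) (X : 'M[K]_(#|S|, k)) (N : 'M[K]_(m, k)) :
    'M[K]_(m, k) :=
  \matrix_(i, j) if [pick s : 'I_#|S| | enum_val s == i] is Some s then X s j
                 else N i j.

Definition block_decomposed r (B : {set block m r}) (M : 'M[K]_(m, r)) : Prop :=
  [/\ forall i, exists! b, b \in B /\ i \in b.1,
      forall j, exists! b, b \in B /\ j \in b.2
    & forall i j, M i j != 0 -> exists b, [/\ b \in B, i \in b.1 & j \in b.2]].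

Definition join r (B : {set block m r}) : block m r :=
  (\bigcup_(b in B) b.1, \bigcup_(b in B) b.2).

Definition indec_decomposition d r (G : 'I_m -> deg d) (R : 'I_r -> deg d)
    (B : {set block m r}) (M : 'M[K]_(m, r)) : Prop :=
  block_decomposed B M /\
  forall b, b \in B ->
    indecomposable (coker (degs b.1 G) (degs b.2 R) (submx b M)).

End Blocks.

(* Column degrees of [M N], with k columns of degree alpha in N. *)
Definition addcols d r (R : 'I_r -> deg d) k (alpha : deg d) :
    'I_(r + k) -> deg d :=
  fun j => match split j with inl j' => R j' | inr _ => alpha end.

Definition alpha_decomposed (K : fieldType) d m r (G : 'I_m -> deg d)
    (R : 'I_r -> deg d) k (alpha : deg d) (B : {set block m r})
    (M : 'M[K]_(m, r)) (N : 'M[K]_(m, k)) : Prop :=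
  [/\ graded G (addcols R alpha) (row_mx M N),
      minimal G (addcols R alpha) (row_mx M N),
      indec_decomposition G R B M
    & forall j, ~~ ledeg alpha (R j)].

Section Dec.

Variable K : finFieldType.

(* A matrix [T_1 T_2] with k rows and k columns, where T_1 has l columns. *)
Definition splitmx (k : nat) := {l : nat & ('M[K]_(k, l) * 'M[K]_(k, k - l))%type}.

Definition sp1 k (t : splitmx k) : 'M[K]_(k, tag t) := (tagged t).1.
Definition sp2 k (t : splitmx k) : 'M[K]_(k, k - tag t) := (tagged t).2.

Definition colspace k l (T : 'M[K]_(k, l)) : {vspace 'cV[K]_k} :=
  (\sum_(j < l) <[col j T]>)%VS.

(* The pivot of a nonzero vector is the position of its first nonzero entry. *)
Definition pivots k (V : {vspace 'cV[K]_k}) : {set 'I_k} :=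
  [set p | [exists v : 'cV[K]_k,
    [&& v \in V, v p 0 != 0 & [forall i : 'I_k, (i < p)%N ==> (v i 0 == 0)]]]].

(* Reduced column-echelon form, with pivot rows p. *)
Definition col_echelon k l (T : 'M[K]_(k, l)) : Prop :=
  exists p : 'I_l -> 'I_k,
    [/\ forall j j' : 'I_l, (j < j')%N -> (p j < p j')%N,
        forall (i : 'I_k) j, (i < p j)%N -> T i j = 0
      & forall j j', T (p j) j' = (j == j')%:R].

Definition first_pivot k (V : {vspace 'cV[K]_k}) : bool :=
  [exists p in pivots V, p == 0%N :> nat].

(* s lists the elements of Dec_q(k), in any order. [T_1 T_2] has l + (k - l)
   columns, which is k but not by conversion, so that being invertible is
   expressed by the rank. *)
Definition is_dec k (s : seq (splitmx k)) : Prop :=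
  [/\ forall t, t \in s ->
        [/\ (0 < tag t)%N, (2 * tag t <= k)%N, col_echelon (sp1 t),
            row_free (row_mx (sp1 t) (sp2 t)) && row_full (row_mx (sp1 t) (sp2 t))
          & pivots (colspace (sp2 t)) = ~: pivots (colspace (sp1 t))],
      forall t, t \in s -> (2 * tag t)%N = k -> first_pivot (colspace (sp1 t))
    & forall V : {vspace 'cV[K]_k},
        (0 < \dim V)%N -> (2 * \dim V <= k)%N ->
        ((2 * \dim V)%N = k -> first_pivot V) ->
        exists! t, t \in s /\ colspace (sp1 t) = V].

End Dec.

(* The algorithm changes N only: the row additions Q are compensated in M by
   the column additions P. So M and its degrees are fixed, a presentation
   [M_B N] is given by the set B of blocks of M and by N, and the rows of N
   outside B are zero. As solutions Q, P, U and the order in which blocks are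
   treated are not prescribed, the algorithm is a relation between inputs and
   outputs. *)
Section Algorithm.

Variables (K : finFieldType) (d m r : nat).
Variables (G : 'I_m -> deg d) (R : 'I_r -> deg d) (alpha : deg d).
Variable M : 'M[K]_(m, r).
Variable dec : forall k, seq (splitmx K k).

Implicit Types (b c : block m r) (B : {set block m r}).

Definition reduction B b l (N : 'M[K]_(m, l))
    (Q : forall c, 'M[K]_(#|b.1|, #|c.1|)) (P : forall c, 'M[K]_(#|b.2|, #|c.2|))
    (U : 'M[K]_(#|b.2|, l)) : Prop :=
  [/\ forall c, c \in B -> c != b ->
        [/\ graded (degs b.1 G) (degs c.1 G) (Q c),
            graded (degs b.2 R) (degs c.2 R) (P c)
          & Q c *m submx c M + submx b M *m P c = 0],
      graded (degs b.2 R) (fun=> alpha) U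
    & rsub b.1 N + \sum_(c in B | c != b) Q c *m rsub c.1 N + submx b M *m U
      = 0].

(* BlockReduce(b) for [M_B N1], with the row additions applied to N2 as well. *)
Inductive block_reduce B b l1 l2 (N1 : 'M[K]_(m, l1)) (N2 : 'M[K]_(m, l2)) :
    'M[K]_(m, l1) -> 'M[K]_(m, l2) -> Prop :=
| BR_clear Q P U : reduction B N1 Q P U ->
    block_reduce B b N1 N2 (setrows (S := b.1) 0 N1)
      (setrows (rsub b.1 N2 + \sum_(c in B | c != b) Q c *m rsub c.1 N2) N2)
| BR_keep : (forall Q P U, ~ @reduction B b l1 N1 Q P U) ->
    block_reduce B b N1 N2 N1 N2.

Inductive reduce_all B l1 l2 : seq (block m r) ->
    'M[K]_(m, l1) -> 'M[K]_(m, l2) -> 'M[K]_(m, l1) -> 'M[K]_(m, l2) -> Prop :=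
| RA_nil N1 N2 : reduce_all B [::] N1 N2 N1 N2
| RA_cons b s N1 N2 N1' N2' N1'' N2'' :
    block_reduce B b N1 N2 N1' N2' -> reduce_all B s N1' N2' N1'' N2'' ->
    reduce_all B (b :: s) N1 N2 N1'' N2''.

Definition uncleared B l (N : 'M[K]_(m, l)) : {set block m r} :=
  [set b in B | rsub b.1 N != 0].

Definition joint_reduction B1 B2 l1 l2 (N1 : 'M[K]_(m, l1)) (N2 : 'M[K]_(m, l2))
    : Prop :=
  let b1 := join B1 in let b2 := join B2 in
  exists (Q : 'M[K]_(#|b1.1|, #|b2.1|)) (P : 'M[K]_(#|b1.2|, #|b2.2|))
         (U : 'M[K]_(#|b1.2|, l2)) (W : 'M[K]_(l1, l2)),
    [/\ graded (degs b1.1 G) (degs b2.1 G) Q,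
        graded (degs b1.2 R) (degs b2.2 R) P,
        graded (degs b1.2 R) (fun=> alpha) U,
        Q *m submx b2 M + submx b1 M *m P = 0
      & rsub b1.1 N2 + Q *m rsub b2.1 N2 + submx b1 M *m U + rsub b1.1 N1 *m W
        = 0].

(* A matrix rN with rk columns, and blocks of [M rN]. *)
Record result := Result {
  rk : nat;
  rN : 'M[K]_(m, rk);
  rB : {set block m (r + rk)}
}.

Definition recol n n' (f : 'I_n -> 'I_n') (b : block m n) : block m n' :=
  (b.1, f @: b.2).

Definition widen k (b : block m r) : block m (r + k) := recol (@lshift r k) b.

Definition single B k (N : 'M[K]_(m, k)) : result :=
  Result N [set ((join B).1, lshift k @: (join B).2 :|: @rshift r k @: [set: 'I_k])].

Definition lcol k1 k2 (j : 'I_(r + k1)) : 'I_(r + (k1 + k2)) :=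
  match split j with
  | inl j' => lshift (k1 + k2) j'
  | inr j' => rshift r (lshift k2 j')
  end.

Definition rcol k1 k2 (j : 'I_(r + k2)) : 'I_(r + (k1 + k2)) :=
  match split j with
  | inl j' => lshift (k1 + k2) j'
  | inr j' => rshift r (rshift k1 j')
  end.

Definition glue (res1 res2 : result) : result :=
  Result (row_mx (rN res1) (rN res2))
    (recol (@lcol (rk res1) (rk res2)) @: rB res1 :|:
     recol (@rcol (rk res1) (rk res2)) @: rB res2).

(* [attempts s B N res]: res is returned when the elements of s remain to be
   tried. *)
Inductive exhaustive : forall k, {set block m r} -> 'M[K]_(m, k) -> result -> Prop :=
| Exhaustive k B (N : 'M[K]_(m, k)) res :
    attempts (dec k) B N res -> exhaustive B N res
with attempts : forall k, seq (splitmx K k) ->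
    {set block m r} -> 'M[K]_(m, k) -> result -> Prop :=
| AT_none k B (N : 'M[K]_(m, k)) : attempts [::] B N (single B N)
| AT_success k (t : splitmx K k) ts B (N : 'M[K]_(m, k)) s N1 N2 res1 res2 :
    perm_eq s (enum B) ->
    reduce_all B s (N *m sp1 t) (N *m sp2 t) N1 N2 ->
    let B1 := uncleared B N1 in let B2 := B :\: B1 in
    joint_reduction B1 B2 N1 N2 ->
    exhaustive B1 N1 res1 ->
    exhaustive B2 (setrows (S := (join B1).1) 0 N2) res2 ->
    attempts (t :: ts) B N (glue res1 res2)
| AT_failure k (t : splitmx K k) ts B (N : 'M[K]_(m, k)) s N1 N2 res :
    perm_eq s (enum B) ->
    reduce_all B s (N *m sp1 t) (N *m sp2 t) N1 N2 ->
    let B1 := uncleared B N1 in let B2 := B :\: B1 in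
    ~ joint_reduction B1 B2 N1 N2 ->
    attempts ts B N res ->
    attempts (t :: ts) B N res.

(* The initial BlockReduce calls clear with all the columns of N; there are no
   further columns to carry along. *)
Inductive exhaustive_alpha_decomposition k B (N : 'M[K]_(m, k)) : result -> Prop :=
| AD_finished s N' Z :
    perm_eq s (enum B) ->
    reduce_all B s N (0 : 'M[K]_(m, 0)) N' Z ->
    uncleared B N' = set0 ->
    exhaustive_alpha_decomposition B N (Result N' [set widen k b | b in B])
| AD_call s N' Z res :
    perm_eq s (enum B) ->
    reduce_all B s N (0 : 'M[K]_(m, 0)) N' Z ->
    uncleared B N' != set0 ->
    exhaustive (uncleared B N') N' res ->
    exhaustive_alpha_decomposition B N
      (Result (rN res)
        ([set widen (rk res) b | b in B :\: uncleared B N'] :|: rB res)).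

End Algorithm.

(* Main.v *)
Require Import Defs.
From HB Require Import structures.
From mathcomp Require Import all_boot all_order all_algebra.
From mathcomp Require Import zify.
From Stdlib Require Import Classical_Prop.

Set Implicit Arguments.
Unset Strict Implicit.
Unset Printing Implicit Defensive.

Import Order.TTheory GRing.Theory Num.Theory.
Local Open Scope ring_scope.

Local Notation submx := Defs.submx.

(** The proof works with matrices and reaches graded modules only at both ends.
    An endomorphism of the presentation [M] is a graded square matrix [phi] with
    [phi M = M P]; it induces zero on the cokernel exactly when [phi = M U] for
    a graded [U] ([nul]). Block projections are diagonal 0-1 matrices, so that
    all the row operations of the algorithm become endomorphisms of the one
    matrix [M]. Since the field is finite, every matrix has an idempotent power
    ([idempotent_power]); this does the work of Fitting's lemma and of lifting
    idempotents. It shows that a presentation with indecomposable cokernel is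
    one in which every idempotent [q] satisfies [q = 0] or [q = 1] up to [nul]
    ([idempotent_of_indecomposable], [split_of_idempotents]).

    A block [b] is clearable when some endomorphism into [b] that is the
    identity on [b] kills [N] up to [nul]; this is what BlockReduce decides. All
    recursive calls are made on inputs ([admissible]) whose columns are
    independent modulo the image of [M], which follows from minimality, and in
    which no block is clearable. The exchange property
    ([idempotent_annih_nul]) turns the second condition, about single blocks,
    into one about all direct summands: an idempotent that kills [N] vanishes.

    The algorithm misses no decomposition ([joint_of_idempotent]). A
    decomposition of the cokernel of [M N] gives an idempotent endomorphism [e]
    of [M] with [e N = N W] up to [nul], because no column of [M] has degree at
    least [alpha]. By independence [W] is idempotent; by the exchange property
    neither [e N] nor [(1 - e) N] vanishes unless [e] or [1 - e] does. So [W] or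
    [1 - W] has an image that Dec lists ([dec_choice]). For the corresponding
    [T_1 T_2], let [p] project onto the blocks that [N_1] still meets, and let
    [e'] be [e] transported along the row operations made so far. Then [p e' p]
    fixes [N_1], hence is invertible on the image of [p], again by the exchange
    property, and [(p e' p)^-1 p e'] is the morphism that the joint reduction
    looks for.

    Conversely, a successful joint reduction yields an isomorphic presentation
    in two diagonal halves, both admissible again ([success_inheritance]); a
    clearable block in the second half would give a nonzero idempotent that
    kills [N]. Induction over the run then shows that every output block is
    indecomposable or zero, and a zero block could be deleted from the minimal
    presentation ([minimal_block_nonzero]). Runs exist because the number of
    columns of [N] decreases. *)

(** * Graded matrices and endomorphisms of a presentation *)

Section GradedAlgebra.

Variables (K : fieldType) (d : nat).

Lemma graded0 m n (G : 'I_m -> deg d) (D : 'I_n -> deg d) :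
  graded G D (0 : 'M[K]_(m, n)).
Proof. by move=> i j _; rewrite mxE. Qed.

Lemma gradedD m n (G : 'I_m -> deg d) (D : 'I_n -> deg d) (A B : 'M[K]_(m, n)) :
  graded G D A -> graded G D B -> graded G D (A + B).
Proof. by move=> hA hB i j h; rewrite mxE hA ?hB ?addr0. Qed.

Lemma gradedN m n (G : 'I_m -> deg d) (D : 'I_n -> deg d) (A : 'M[K]_(m, n)) :
  graded G D A -> graded G D (- A).
Proof. by move=> hA i j h; rewrite mxE hA ?oppr0. Qed.

Lemma gradedB m n (G : 'I_m -> deg d) (D : 'I_n -> deg d) (A B : 'M[K]_(m, n)) :
  graded G D A -> graded G D B -> graded G D (A - B).
Proof. by move=> hA hB; apply: gradedD => //; apply: gradedN. Qed.

Lemma graded1 m (G : 'I_m -> deg d) : graded G G (1%:M : 'M[K]_m).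
Proof.
move=> i j; rewrite mxE; case: eqP => // ->.
by rewrite ledeg_refl.
Qed.

Lemma gradedM m n l (G : 'I_m -> deg d) (D : 'I_n -> deg d) (R : 'I_l -> deg d)
    (A : 'M[K]_(m, n)) (B : 'M[K]_(n, l)) :
  graded G D A -> graded D R B -> graded G R (A *m B).
Proof.
move=> hA hB i j h; rewrite mxE big1 // => k _.
case: (boolP (ledeg (G i) (D k))) => [Gk|/hA->]; last by rewrite mul0r.
rewrite hB ?mulr0 //; apply: contra h; exact: ledeg_trans.
Qed.

(** With all columns in one degree, every scalar matrix is a graded change of
    columns. *)
Lemma gradedMc m k l (G : 'I_m -> deg d) (z : deg d) (A : 'M[K]_(m, k))
    (T : 'M[K]_(k, l)) :
  graded G (fun=> z) A -> graded G (fun=> z) (A *m T).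
Proof. by move=> hA i j h; rewrite mxE big1 // => s _; rewrite hA ?mul0r. Qed.

(** [addcols R z] is [catdeg R (fun=> z)] by conversion. *)
Definition catdeg n k (R : 'I_n -> deg d) (D : 'I_k -> deg d) (j : 'I_(n + k)) :=
  match split j with inl j' => R j' | inr j' => D j' end.

Lemma graded_row_mx m n k (G : 'I_m -> deg d) (R : 'I_n -> deg d)
    (D : 'I_k -> deg d) (A : 'M[K]_(m, n)) (B : 'M[K]_(m, k)) :
  graded G (catdeg R D) (row_mx A B) <-> graded G R A /\ graded G D B.
Proof.
split=> [h|[hA hB] i j].
  split=> i j hij.
    by have := h i (lshift k j); rewrite /catdeg (unsplitK (inl j)) row_mxEl => ->.
  by have := h i (rshift n j); rewrite /catdeg (unsplitK (inr j)) row_mxEr => ->.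
by rewrite /catdeg mxE; case: splitP => j' _ ; [apply: hA | apply: hB].
Qed.

Lemma graded_col_mx m n k (G : 'I_m -> deg d) (R : 'I_n -> deg d)
    (D : 'I_k -> deg d) (A : 'M[K]_(n, m)) (B : 'M[K]_(k, m)) :
  graded (catdeg R D) G (col_mx A B) <-> graded R G A /\ graded D G B.
Proof.
split=> [h|[hA hB] i j].
  split=> i j hij.
    by have := h (lshift k i) j; rewrite /catdeg (unsplitK (inl i)) col_mxEu => ->.
  by have := h (rshift n i) j; rewrite /catdeg (unsplitK (inr i)) col_mxEd => ->.
by rewrite /catdeg mxE; case: splitP => j' _ ; [apply: hA | apply: hB].
Qed.

Lemma graded_row_mxc m n k (G : 'I_m -> deg d) (z : deg d) (A : 'M[K]_(m, n))
    (B : 'M[K]_(m, k)) : graded G (fun=> z) A -> graded G (fun=> z) B ->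
  graded G (fun=> z) (row_mx A B).
Proof. by move=> hA hB i j hij; rewrite mxE; case: split => j'; rewrite ?hA ?hB. Qed.

Section Presentation.

Variables (m r : nat) (G : 'I_m -> deg d) (R : 'I_r -> deg d).
Variable M : 'M[K]_(m, r).

(** The matrices whose columns lie in the graded image of [M], that is, the
    maps that become zero in the cokernel. *)
Definition nul l (D : 'I_l -> deg d) (A : 'M[K]_(m, l)) : Prop :=
  exists2 U, graded R D U & A = M *m U.

Definition endo (phi : 'M[K]_m) : Prop :=
  graded G G phi /\ exists2 P, graded R R P & phi *m M = M *m P.

Lemma nul0 l (D : 'I_l -> deg d) : nul D 0.
Proof. by exists 0; [apply: graded0 | rewrite mulmx0]. Qed.

Lemma nulD l (D : 'I_l -> deg d) A B : nul D A -> nul D B -> nul D (A + B).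
Proof.
by move=> [U hU ->] [V hV ->]; exists (U + V); [apply: gradedD | rewrite mulmxDr].
Qed.

Lemma nulN l (D : 'I_l -> deg d) A : nul D A -> nul D (- A).
Proof. by move=> [U hU ->]; exists (- U); [apply: gradedN | rewrite mulmxN]. Qed.

Lemma nulB l (D : 'I_l -> deg d) A B : nul D A -> nul D B -> nul D (A - B).
Proof. by move=> hA hB; apply: nulD => //; apply: nulN. Qed.

Lemma nul_addIr l (D : 'I_l -> deg d) A B : nul D B -> nul D (A + B) -> nul D A.
Proof. by move=> hB hA; rewrite -[A](addrK B); apply: nulB. Qed.

Lemma nul_mulr l l' (D : 'I_l -> deg d) (D' : 'I_l' -> deg d) A C :
  nul D A -> graded D D' C -> nul D' (A *m C).
Proof.
by move=> [U hU ->] hC; exists (U *m C); [apply: gradedM hC | rewrite mulmxA].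
Qed.

Lemma nul_mulc l l' (z : deg d) A (C : 'M[K]_(l, l')) :
  nul (fun=> z) A -> nul (fun=> z) (A *m C).
Proof.
by move=> [U hU ->]; exists (U *m C); [apply: gradedMc | rewrite mulmxA].
Qed.

Lemma nul_endol l (D : 'I_l -> deg d) phi A : endo phi -> nul D A -> nul D (phi *m A).
Proof.
move=> [_ [P hP eP]] [U hU ->]; exists (P *m U); first exact: gradedM hU.
by rewrite mulmxA eP mulmxA.
Qed.

Lemma endo0 : endo 0.
Proof.
by split; [apply: graded0 | exists 0; [apply: graded0 | rewrite mul0mx mulmx0]].
Qed.

Lemma endo1 : endo 1%:M.
Proof.
by split; [apply: graded1 | exists 1%:M; [apply: graded1 | rewrite mul1mx mulmx1]].
Qed.

Lemma endoD phi psi : endo phi -> endo psi -> endo (phi + psi).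
Proof.
move=> [h [P hP eP]] [h' [P' hP' eP']]; split; first exact: gradedD.
by exists (P + P'); [apply: gradedD | rewrite mulmxDl mulmxDr eP eP'].
Qed.

Lemma endoN phi : endo phi -> endo (- phi).
Proof.
move=> [h [P hP eP]]; split; first exact: gradedN.
by exists (- P); [apply: gradedN | rewrite mulNmx mulmxN eP].
Qed.

Lemma endoB phi psi : endo phi -> endo psi -> endo (phi - psi).
Proof. by move=> h h'; apply: endoD => //; apply: endoN. Qed.

Lemma endoM phi psi : endo phi -> endo psi -> endo (phi *m psi).
Proof.
move=> [h [P hP eP]] [h' [P' hP' eP']]; split; first exact: gradedM h'.
by exists (P *m P'); [apply: gradedM hP' | rewrite -mulmxA eP' mulmxA eP mulmxA].
Qed.

Lemma endo_sum (I : Type) (s : seq I) (Q : pred I) F :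
  (forall i, Q i -> endo (F i)) -> endo (\sum_(i <- s | Q i) F i).
Proof.
by move=> h; apply: (big_ind endo) => //; [apply: endo0 | apply: endoD].
Qed.

Lemma endoX phi n : endo phi -> endo (phi ^+ n).
Proof.
move=> h; elim: n => [|n IHn]; first exact: endo1.
by rewrite exprS -mulmxE; apply: endoM.
Qed.

End Presentation.

Lemma nul_row_mx m r n k (R : 'I_r -> deg d) (M : 'M[K]_(m, r))
    (D : 'I_n -> deg d) (E : 'I_k -> deg d) (A : 'M[K]_(m, n)) (B : 'M[K]_(m, k)) :
  nul R M (catdeg D E) (row_mx A B) <-> nul R M D A /\ nul R M E B.
Proof.
split=> [[U hU]|[[U hU ->] [V hV ->]]]; last first.
  by exists (row_mx U V); [apply/graded_row_mx | rewrite mul_mx_row].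
rewrite -[U]hsubmxK mul_mx_row => /eq_row_mx[-> ->].
move: hU; rewrite -{1}[U]hsubmxK => /graded_row_mx[hl hr].
by split; [exists (lsubmx U) | exists (rsubmx U)].
Qed.

Lemma nul_of_row_mx m r k (R : 'I_r -> deg d) (M : 'M[K]_(m, r)) (S : 'I_k -> deg d)
    (N : 'M[K]_(m, k)) n (D : 'I_n -> deg d) (A : 'M[K]_(m, n)) :
  nul (catdeg R S) (row_mx M N) D A <->
  exists U V, [/\ graded R D U, graded S D V & A = M *m U + N *m V].
Proof.
split=> [[U hU]|[U [V [hU hV ->]]]]; last first.
  by exists (col_mx U V); [apply/graded_col_mx | rewrite mul_row_col].
rewrite -[U]vsubmxK mul_row_col => ->.
move: hU; rewrite -{1}[U]vsubmxK => /graded_col_mx[hu hd].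
by exists (usubmx U), (dsubmx U).
Qed.

Lemma span_lines_mem (V : vectType K) n (P : pred 'I_n) (x : 'I_n -> V) v :
  v \in (\sum_(j | P j) <[x j]>)%VS <->
  exists a : 'I_n -> K, v = \sum_(j | P j) a j *: x j.
Proof.
split=> [/memv_sumP[f hf ->]|[a ->]]; last first.
  apply: memv_suml => j Pj; apply: (subvP (sumv_sup j Pj (subvv _))).
  by rewrite memvZ ?memv_line.
have/fin_all_exists[a ha] : forall j, exists c, P j -> f j = c *: x j.
  move=> j; case: (boolP (P j)) => [Pj|_]; last by exists 0.
  by have/vlineP[c ->] := hf j Pj; exists c.
by exists a; apply: eq_bigr.
Qed.

Lemma mulmx_sum_col n l (A : 'M[K]_(n, l)) (u : 'cV[K]_l) :
  A *m u = \sum_j u j 0 *: col j A.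
Proof.
apply/colP => i; rewrite mxE summxE; apply: eq_bigr => j _.
by rewrite !mxE mulrC.
Qed.

End GradedAlgebra.

(** * Cokernels of graded matrices *)

Section GradedModuleIso.

Variables (K : fieldType) (d : nat).
Implicit Types X Y Z : gmodule K d.

Lemma gmiso_trans X Y Z : gmiso X Y -> gmiso Y Z -> gmiso X Z.
Proof.
move=> [f [flin fbij fmon]] [g [glin gbij gmon]]; exists (fun z => g z \o f z).
split=> [z a u v|z|z w h v] /=; first by rewrite flin glin.
  by apply: bij_comp.
by rewrite fmon gmon.
Qed.

End GradedModuleIso.

Section Cokernel.

Variables (K : fieldType) (d m r : nat) (G : 'I_m -> deg d) (R : 'I_r -> deg d).
Variable M : 'M[K]_(m, r).

Lemma mem_gensP z (v : 'cV[K]_m) :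
  v \in gens K G z <-> graded G (fun _ : 'I_1 => z) v.
Proof.
split=> [/span_lines_mem[a ->] i j|h].
  move=> hi; rewrite ord1 summxE big1 // => i' hi'; rewrite !mxE.
  by case: eqP => [ii|_]; [rewrite ii hi' in hi | rewrite mulr0].
apply/span_lines_mem; exists (fun i => v i 0); apply/colP => i; rewrite summxE.
case: (boolP (ledeg (G i) z)) => hi.
  rewrite (bigD1 i) //= big1 ?addr0 ?mxE ?eqxx ?mulr1 // => i' /andP[_ ne].
  by rewrite !mxE eq_sym (negPf ne) mulr0.
rewrite h // big1 // => i' hi'; rewrite !mxE.
by case: eqP => [ii|_]; [rewrite ii hi' in hi | rewrite mulr0].
Qed.

Lemma mem_relsP z (v : 'cV[K]_m) : v \in rels R M z <-> nul R M (fun=> z) v.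
Proof.
split=> [/span_lines_mem[a ->]|[u hu ->]].
  exists (\col_j if ledeg (R j) z then a j else 0).
    by move=> j s; rewrite mxE => /negPf->.
  rewrite mulmx_sum_col big_mkcond; apply: eq_bigr => j _; rewrite mxE.
  by case: ifP => // _; rewrite scale0r.
apply/span_lines_mem; exists (fun j => u j 0).
rewrite mulmx_sum_col [RHS]big_mkcond; apply: eq_bigr => j _.
by case: ifP => // /negbT hj; rewrite hu ?scale0r.
Qed.

Lemma nul_rels l (D : 'I_l -> deg d) (A : 'M[K]_(m, l)) :
  nul R M D A <-> forall j, col j A \in rels R M (D j).
Proof.
split=> [[U hU ->] j|h].
  apply/mem_relsP; exists (col j U); last by rewrite !colE mulmxA.
  by move=> i s hi; rewrite mxE hU.
have/fin_all_exists[U hU] : forall j, exists u : 'cV[K]_r,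
    graded R (fun _ : 'I_1 => D j) u /\ col j A = M *m u.
  by move=> j; have/mem_relsP[u hu e] := h j; exists u.
exists (\matrix_(i, j) U j i 0).
  by move=> i j hi; rewrite mxE (hU j).1.
apply/matrixP => i j; have/colP/(_ i) := (hU j).2.
by rewrite !mxE => ->; apply: eq_bigr => s _; rewrite mxE.
Qed.

Definition cls z (v : 'cV[K]_m) : coker G R M z :=
  vproj (grels G R M z) (vsproj (gens K G z) v).

Definition rep z (x : coker G R M z) : 'cV[K]_m := vsval (vrep x).

Lemma cls_linear z : linear (@cls z).
Proof. by move=> a u v; rewrite /cls linearP vproj_linear. Qed.

HB.instance Definition _ z :=
  GRing.isLinear.Build K 'cV[K]_m (coker G R M z) _ (@cls z) (@cls_linear z).

Lemma rep_gens z (x : coker G R M z) : graded G (fun _ : 'I_1 => z) (rep x).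
Proof. by apply/mem_gensP; apply: subvsP. Qed.

Lemma repK z : cancel (@rep z) (@cls z).
Proof. by move=> x; rewrite /cls /rep vsvalK vrepK. Qed.

Lemma cls0P z v : graded G (fun _ : 'I_1 => z) v ->
  cls z v = 0 <-> nul R M (fun=> z) v.
Proof.
move/mem_gensP => hv; rewrite -(linear0 (@cls z)).
apply: (iff_trans (vprojE _ _ _)); rewrite linear0 subr0 mem_grels vsprojK //.
exact: mem_relsP.
Qed.

Lemma rep_clsP z v : graded G (fun _ : 'I_1 => z) v ->
  nul R M (fun _ : 'I_1 => z) (rep (cls z v) - v).
Proof.
move=> hv; apply/cls0P; first by apply: gradedB => //; apply: rep_gens.
by rewrite linearB /= repK subrr.
Qed.

Lemma mon_cls z w (h : ledeg z w) v : graded G (fun _ : 'I_1 => z) v ->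
  mon h (cls z v) = cls w v.
Proof. by move/mem_gensP => hv; rewrite /cls /= coker_monE vsprojK. Qed.

(** The cokernel vanishes when its generators do, and the generators are the
    columns of the identity matrix. *)
Lemma coker_zeroP : gmzero (coker G R M) <-> nul R M G 1%:M.
Proof.
have g1 j : graded G (fun _ : 'I_1 => G j) (col j (1%:M : 'M[K]_m)).
  move=> i s hi; rewrite mxE; exact: graded1 hi.
split=> [h|[U hU e] z x].
  by apply/nul_rels => j; apply/mem_relsP; apply/cls0P.
rewrite -[x]repK; apply/cls0P; first exact: rep_gens.
rewrite -[rep x]mul1mx e; exists (U *m rep x); last by rewrite mulmxA.
by apply: gradedM hU _; apply: rep_gens.
Qed.

End Cokernel.

Section CokernelMaps.

Variables (K : fieldType) (d : nat).

Section Map.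

Variables (m r : nat) (G : 'I_m -> deg d) (R : 'I_r -> deg d) (M : 'M[K]_(m, r)).
Variables (m' r' : nat) (G' : 'I_m' -> deg d) (R' : 'I_r' -> deg d).
Variables (M' : 'M[K]_(m', r')) (F : 'M[K]_(m', m)).
Hypotheses (gF : graded G' G F) (nF : nul R' M' R (F *m M)).

Definition coker_map z (x : coker G R M z) : coker G' R' M' z :=
  cls G' R' M' z (F *m rep x).

(** A map is given on representatives; it does not depend on their choice
    because [F] sends relations to relations. *)
Lemma coker_map_cls z v : graded G (fun _ : 'I_1 => z) v ->
  coker_map (cls G R M z v) = cls G' R' M' z (F *m v).
Proof.
move=> hv; apply/eqP; rewrite -subr_eq0 -linearB /= -mulmxBr; apply/eqP.
have [u hu e] := rep_clsP R M hv.
apply/cls0P; first by apply: (gradedM gF); apply: gradedB hv; apply: rep_gens.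
by rewrite e mulmxA; apply: nul_mulr hu.
Qed.

Lemma coker_map_linear z : linear (@coker_map z).
Proof.
move=> a x y; rewrite -[x]repK -[y]repK -linearP.
have hx := rep_gens x; have hy := rep_gens y.
rewrite !coker_map_cls // ?mulmxDr -?scalemxAr ?linearP //.
apply: gradedD => // i j hij; rewrite mxE hx ?mulr0 //.
Qed.

Lemma coker_map_mon z w (h : ledeg z w) x :
  coker_map (mon h x) = mon h (coker_map x).
Proof.
have hx := rep_gens x; rewrite -[x]repK mon_cls // !coker_map_cls //.
  by rewrite mon_cls //; apply: gradedM hx.
by move=> i j hi; apply: hx; apply: contra hi => hi; apply: ledeg_trans h.
Qed.

End Map.

(** Being inverse up to [nul] is enough, as [nul] matrices induce zero. *)
Lemma coker_iso m r (G : 'I_m -> deg d) (R : 'I_r -> deg d) (M : 'M[K]_(m, r))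
    m' r' (G' : 'I_m' -> deg d) (R' : 'I_r' -> deg d) (M' : 'M[K]_(m', r'))
    (F : 'M[K]_(m', m)) (F' : 'M[K]_(m, m')) :
  graded G' G F -> nul R' M' R (F *m M) ->
  graded G G' F' -> nul R M R' (F' *m M') ->
  nul R M G (F' *m F - 1%:M) -> nul R' M' G' (F *m F' - 1%:M) ->
  gmiso (coker G R M) (coker G' R' M').
Proof.
move=> gF nF gF' nF' nF'F nFF'; exists (fun z => @coker_map _ _ G R M _ _ G' R' M' F z).
split=> [z|z|z w h x]; [exact: coker_map_linear| |exact: coker_map_mon].
exists (@coker_map _ _ G' R' M' _ _ G R M F' z) => x; have hx := rep_gens x.
  rewrite -[x]repK !coker_map_cls //; last exact: gradedM hx.
  apply/eqP; rewrite -subr_eq0 -linearB /=; apply/eqP/cls0P.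
    by apply: gradedB => //; apply: (gradedM gF'); apply: gradedM hx.
  by rewrite mulmxA -[X in _ - X]mul1mx -mulmxBl; apply: nul_mulr hx.
rewrite -[x]repK !coker_map_cls //; last exact: gradedM hx.
apply/eqP; rewrite -subr_eq0 -linearB /=; apply/eqP/cls0P.
  by apply: gradedB => //; apply: (gradedM gF); apply: gradedM hx.
by rewrite mulmxA -[X in _ - X]mul1mx -mulmxBl; apply: nul_mulr hx.
Qed.

End CokernelMaps.

(** * Idempotents split cokernels *)

Section Idempotents.

Variables (K : fieldType) (d m r : nat) (G : 'I_m -> deg d) (R : 'I_r -> deg d).
Variable M : 'M[K]_(m, r).

(** The image of the idempotent that [q] induces is the cokernel of
    [M (1 - q)], and its kernel is that of [M q]. *)
Lemma idempotent_split q : endo G R M q -> q *m q = q ->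
  gmiso (coker G R M)
    (dsum (coker G (catdeg R G) (row_mx M q))
          (coker G (catdeg R G) (row_mx M (1%:M - q)))).
Proof.
move=> eq qq; have gq := eq.1.
have g1 : graded G G (1%:M : 'M[K]_m) by apply: graded1.
have e1q : endo G R M (1%:M - q) by apply: endoB => //; apply: endo1.
have nM : nul R M R M by exists 1%:M; [apply: graded1 | rewrite mulmx1].
have qq0 : q *m (1%:M - q) = 0 by rewrite mulmxBr mulmx1 qq subrr.
have qq0' : (1%:M - q) *m q = 0 by rewrite mulmxBl mul1mx qq subrr.
have n1 A : nul (catdeg R G) (row_mx M A) R (1%:M *m M).
  apply/nul_of_row_mx; exists 1%:M, 0; split; [exact: graded1|exact: graded0|].
  by rewrite mul1mx mulmx1 mulmx0 addr0.
have nf : nul R M (catdeg R G) ((1%:M - q) *m row_mx M q).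
  rewrite mul_mx_row; apply/nul_row_mx; split; first exact: nul_endol e1q nM.
  by rewrite qq0'; apply: nul0.
have ng : nul R M (catdeg R G) (q *m row_mx M (1%:M - q)).
  rewrite mul_mx_row; apply/nul_row_mx; split; first exact: nul_endol eq nM.
  by rewrite qq0; apply: nul0.
pose f1 := @coker_map _ _ _ _ G R M _ _ G (catdeg R G) (row_mx M q) 1%:M.
pose f2 := @coker_map _ _ _ _ G R M _ _ G (catdeg R G) (row_mx M (1%:M - q)) 1%:M.
pose h1 := @coker_map _ _ _ _ G (catdeg R G) (row_mx M q) _ _ G R M (1%:M - q).
pose h2 := @coker_map _ _ _ _ G (catdeg R G) (row_mx M (1%:M - q)) _ _ G R M q.
have f1E z v : graded G (fun _ : 'I_1 => z) v -> f1 z (cls G R M z v) = cls _ _ _ z v.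
  by move=> hv; rewrite /f1 coker_map_cls // mul1mx.
have f2E z v : graded G (fun _ : 'I_1 => z) v -> f2 z (cls G R M z v) = cls _ _ _ z v.
  by move=> hv; rewrite /f2 coker_map_cls // mul1mx.
exists (fun z x => (f1 z x, f2 z x)); split=> [z a x y|z|z w h x].
- by rewrite /f1 /f2 !coker_map_linear.
- exists (fun x => h1 z x.1 + h2 z x.2) => [x|[x y]] /=.
    have hx := rep_gens x; rewrite -[x]repK f1E // f2E // /h1 /h2 !coker_map_cls //.
    by rewrite -linearD -mulmxDl subrK mul1mx.
    exact: e1q.1.
  have hx := rep_gens x; have hy := rep_gens y; rewrite -[x]repK -[y]repK.
  rewrite /h1 /h2 !coker_map_cls -?linearD //; last exact: e1q.1.
  have gx : graded G (fun=> z) ((1%:M - q) *m rep x) by apply: gradedM hx; apply: e1q.1.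
  have gy : graded G (fun=> z) (q *m rep y) by apply: gradedM hy.
  rewrite f1E ?f2E; try exact: gradedD.
  congr pair; apply/eqP; rewrite -subr_eq0 -linearB; apply/eqP/cls0P.
  + by apply: gradedB => //; apply: gradedD.
  + apply/nul_of_row_mx; exists 0, (rep y - rep x); split; first exact: graded0.
      exact: gradedB.
    by rewrite mulmx0 add0r mulmxBr mulmxBl mul1mx addrAC [_ - q *m _]addrC addrK addrC.
  + by apply: gradedB => //; apply: gradedD.
  + apply/nul_of_row_mx; exists 0, (rep x - rep y); split; first exact: graded0.
      exact: gradedB.
    by rewrite mulmx0 add0r -addrA mulmxBr; congr (_ + _); rewrite mulmxBl mul1mx opprB.
- by congr pair; apply: coker_map_mon.
Qed.

(** In the splitting by [q], a zero cokernel of [M q] says that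
    [1 = M U + q V], and multiplying by [1 - q] removes the second term. *)
Lemma idempotent_of_indecomposable q :
  indecomposable (coker G R M) -> endo G R M q -> q *m q = q ->
  nul R M G q \/ nul R M G (1%:M - q).
Proof.
move=> [_ ind] eq qq.
have e1q : endo G R M (1%:M - q) by apply: endoB => //; apply: endo1.
have nM : nul R M R M by exists 1%:M; [apply: graded1 | rewrite mulmx1].
have qq0 : q *m (1%:M - q) = 0 by rewrite mulmxBr mulmx1 qq subrr.
have qq0' : (1%:M - q) *m q = 0 by rewrite mulmxBl mul1mx qq subrr.
case: (ind _ _ (idempotent_split eq qq)) => /coker_zeroP/nul_of_row_mx[U [V [hU hV e]]].
  right; have := congr1 (mulmx (1%:M - q)) e.
  rewrite mulmx1 mulmxDr !mulmxA qq0' mul0mx addr0 => ->.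
  by apply: nul_mulr hU; apply: nul_endol e1q nM.
left; have := congr1 (mulmx q) e; rewrite mulmx1 mulmxDr !mulmxA qq0 mul0mx addr0 => ->.
by apply: nul_mulr hU; apply: nul_endol eq nM.
Qed.

End Idempotents.

(** * Decompositions of a cokernel come from idempotents *)

Section FiniteField.

Variables (K : finFieldType) (d m r : nat).
Variables (G : 'I_m -> deg d) (R : 'I_r -> deg d) (M : 'M[K]_(m, r)).

(** The powers of [Q] repeat, say from exponent [x] on with period [p]; then
    the exponent [p (x + 1)] is at least [x] and a multiple of the period. *)
Lemma idempotent_power (Q : 'M[K]_m) :
  exists2 n, (0 < n)%N & Q ^+ n *m Q ^+ n = Q ^+ n.
Proof.
have : ~ injective (fun i : 'I_#|{: 'M[K]_m}|.+1 => Q ^+ i).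
  by move/leq_card; rewrite card_ord ltnn.
move/injectiveP/injectivePn => [x [y ne e]].
wlog lt_xy : x y ne e / (x < y)%N => [h|].
  case: (ltngtP x y) => [lt|lt|/val_inj xy]; first exact: (h x y).
    by apply: (h y x) => //; rewrite eq_sym.
  by rewrite xy eqxx in ne.
pose p := (y - x)%N; have p0 : (0 < p)%N by rewrite subn_gt0.
have per n : (x <= n)%N -> Q ^+ (n + p) = Q ^+ n.
  move=> xn; rewrite -(subnK xn) -addnA exprD [in RHS]exprD; congr (_ * _).
  by rewrite addnC subnK // ltnW.
have pers n s : (x <= n)%N -> Q ^+ (n + p * s) = Q ^+ n.
  move=> xn; elim: s => [|s IHs]; first by rewrite muln0 addn0.
  by rewrite mulnS addnCA addnC per ?IHs // (leq_trans xn) ?leq_addr.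
exists (p * x.+1)%N; first by rewrite muln_gt0 p0.
rewrite mulmxE -exprD pers // (leq_trans (leqnSn _)) // leq_pmull //.
Qed.

(** The projection onto one summand is lifted generator by generator to an
    endomorphism [Q] of the presentation, which is idempotent only up to [nul].
    An idempotent power of [Q] induces the same projection. *)
Lemma split_of_idempotents : graded G R M ->
  (forall q, endo G R M q -> q *m q = q -> nul R M G q \/ nul R M G (1%:M - q)) ->
  forall Y Z : gmodule K d, gmiso (coker G R M) (dsum Y Z) -> gmzero Y \/ gmzero Z.
Proof.
move=> gM triv Y Z [f [flin fbij fmon]].
pose ep z (y : dsum Y Z z) : dsum Y Z z := (y.1, 0).
have ep_lin z a x y : ep z (a *: x + y) = a *: ep z x + ep z y.
  by congr pair; rewrite /= scaler0 addr0.
have ep_mon z w (h : ledeg z w) y : ep w (mon h y) = mon h (ep z y).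
  congr pair; have := mon_linear h (-1) (0 : Z z) 0.
  by rewrite scaler0 addr0 scaleN1r addNr.
pose e k : 'cV[K]_m := col k 1%:M.
have ge k : graded G (fun _ : 'I_1 => G k) (e k).
  by move=> i s hi; rewrite mxE; apply: graded1 hi.
have fsurj z y : exists x, f z x = y by have [g _ gK] := fbij z; exists (g y).
have finj z x x' : f z x = f z x' -> x = x'.
  by have [g fK _] := fbij z => exx; rewrite -(fK x) exx fK.
have f0 z : f z 0 = 0.
  by have := flin z (-1) 0 0; rewrite scaler0 addr0 scaleN1r addNr.
have/fin_all_exists[q hq] : forall k, exists v : 'cV[K]_m,
    graded G (fun _ : 'I_1 => G k) v /\
    f (G k) (cls G R M (G k) v) = ep _ (f (G k) (cls G R M (G k) (e k))).
  move=> k; have [x hx] := fsurj _ (ep _ (f (G k) (cls G R M (G k) (e k)))).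
  by exists (rep x); split; [apply: rep_gens | rewrite repK].
pose Q : 'M[K]_m := \matrix_(i, j) q j i 0.
have gQ : graded G G Q by move=> i j hij; rewrite mxE (hq j).1.
have fsum z (I : Type) (s : seq I) (P : pred I) (a : I -> K) (u : I -> 'cV[K]_m) :
    f z (cls G R M z (\sum_(i <- s | P i) a i *: u i)) =
    \sum_(i <- s | P i) a i *: f z (cls G R M z (u i)).
  elim/big_rec2: _ => [|i y y' _ <-]; first by rewrite linear0 f0.
  by rewrite linearP flin.
have epsum z (I : Type) (s : seq I) (P : pred I) (a : I -> K) u :
    ep z (\sum_(i <- s | P i) a i *: u i) = \sum_(i <- s | P i) a i *: ep z (u i).
  elim/big_rec2: _ => [|i y y' _ <-]; first by [].
  by rewrite ep_lin.
have fQ z v : graded G (fun _ : 'I_1 => z) v ->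
    f z (cls G R M z (Q *m v)) = ep z (f z (cls G R M z v)).
  move=> hv; rewrite -[v in RHS]mul1mx !mulmx_sum_col !fsum epsum.
  apply: eq_bigr => k _; case: (boolP (ledeg (G k) z)) => [h|h]; last first.
    by rewrite hv // !scale0r.
  have -> : col k Q = q k by apply/colP => i; rewrite !mxE.
  rewrite -(mon_cls R M h (hq k).1) -(mon_cls R M h (ge k)); congr (_ *: _).
  have fm := fmon _ _ h; rewrite (fm (cls G R M (G k) (q k))).
  by rewrite (fm (cls G R M (G k) (e k))) (hq k).2 ep_mon.
have clsQ0 z v : graded G (fun _ : 'I_1 => z) v -> nul R M (fun=> z) v ->
    nul R M (fun=> z) (Q *m v).
  move=> hv /(cls0P R M hv) v0; apply/(cls0P R M (gradedM gQ hv)).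
  by apply: finj; rewrite fQ // v0 f0.
have eQ : endo G R M Q -> gmzero Y \/ gmzero Z.
  move=> eQ; have [n n0 idn] := idempotent_power Q.
  have fQn z v : graded G (fun _ : 'I_1 => z) v ->
      f z (cls G R M z (Q ^+ n *m v)) = ep z (f z (cls G R M z v)).
    move=> hv; case: n n0 {idn} => // n _; elim: n => [|n IHn]; first by rewrite fQ.
    rewrite exprS -mulmxE -mulmxA fQ ?IHn //.
    by apply: gradedM hv; apply: (endoX n.+1 eQ).1.
  case: (triv _ (endoX n eQ) idn) => hn; [left => z y|right => z y].
    have [x hx] := fsurj z (y, 0); have gx := rep_gens x.
    have /(cls0P R M (gradedM (endoX n eQ).1 gx)) x0 := nul_mulr hn gx.
    by have := fQn z _ gx; rewrite repK hx x0 f0 => -[].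
  have [x hx] := fsurj z (0, y); have gx := rep_gens x.
  have g1 : graded G G (1%:M - Q ^+ n).
    by apply: gradedB; [apply: graded1 | apply: (endoX n eQ).1].
  have /(cls0P R M (gradedM g1 gx)) := nul_mulr hn gx.
  rewrite mulmxBl mul1mx linearB /= => /subr0_eq; rewrite repK => x0.
  by have := fQn z _ gx; rewrite repK -x0 hx => -[].
apply: eQ; split=> //.
suff [P hP eP] : nul R M R (Q *m M) by exists P.
have nM : nul R M R M by exists 1%:M; [apply: graded1 | rewrite mulmx1].
apply/nul_rels => j; apply/mem_relsP; rewrite colE -mulmxA -colE.
have /nul_rels/(_ j)/mem_relsP hj := nM; apply: clsQ0 => //.
by move=> i s hi; rewrite mxE gM.
Qed.

End FiniteField.

(** * Blocks as corners cut out by diagonal projections *)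

Section Projections.

Variables (K : fieldType) (d n : nat).
Implicit Types S T : {set 'I_n}.

Definition pr S : 'M[K]_n := \matrix_(i, j) ((i == j) && (i \in S))%:R.

(** The inclusion of the coordinates in [S], as a matrix: [rsub], [submx] and
    [setrows] become products with it and its transpose. *)
Definition emb S : 'M[K]_(n, #|S|) := \matrix_(i, s) (i == enum_val s)%:R.

Lemma pr_mull l S (N : 'M[K]_(n, l)) i j :
  (pr S *m N) i j = if i \in S then N i j else 0.
Proof.
rewrite mxE (bigD1 i) //= big1 ?addr0 => [|i' ne]; rewrite mxE.
  by rewrite eqxx; case: ifP; rewrite ?mul1r ?mul0r.
by rewrite eq_sym (negPf ne) mul0r.
Qed.

Lemma pr_mulr l S (N : 'M[K]_(l, n)) i j :
  (N *m pr S) i j = if j \in S then N i j else 0.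
Proof.
rewrite mxE (bigD1 j) //= big1 ?addr0 => [|i' ne]; rewrite mxE.
  by rewrite eqxx; case: ifP; rewrite ?mulr1 ?mulr0.
by rewrite (negPf ne) mulr0.
Qed.

Lemma pr_mul S T : pr S *m pr T = pr (S :&: T).
Proof.
apply/matrixP => i j; rewrite pr_mull !mxE inE.
by case: (i \in S); rewrite ?andbF ?andbT.
Qed.

Lemma prK S : pr S *m pr S = pr S.
Proof. by rewrite pr_mul setIid. Qed.

Lemma pr0 : pr set0 = 0.
Proof. by apply/matrixP => i j; rewrite !mxE inE andbF. Qed.

Lemma prT : pr setT = 1%:M.
Proof. by apply/matrixP => i j; rewrite !mxE inE andbT. Qed.

Lemma prU S T : [disjoint S & T] -> pr (S :|: T) = pr S + pr T.
Proof.
move=> dis; apply/matrixP => i j; rewrite !mxE inE.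
case: eqP => _; rewrite ?addr0 //=; case: (boolP (i \in S)) => iS /=.
  by rewrite (disjointFr dis iS) addr0.
by rewrite add0r.
Qed.

Lemma prC S : pr (~: S) = 1%:M - pr S.
Proof.
by apply/eqP; rewrite eq_sym subr_eq addrC -prU ?setUCr ?prT // disjoints_subset setCK.
Qed.

Lemma embTE l S (N : 'M[K]_(n, l)) : (emb S)^T *m N = rsub S N.
Proof.
apply/matrixP => s j; rewrite !mxE (bigD1 (enum_val s)) //= big1 => [|i ne].
  by rewrite addr0 !mxE eqxx mul1r.
by rewrite !mxE (negPf ne) mul0r.
Qed.

Lemma mul_embE l S (N : 'M[K]_(l, n)) : N *m emb S = colsub (@enum_val _ (mem S)) N.
Proof.
apply/matrixP => i s; rewrite !mxE (bigD1 (enum_val s)) //= big1 => [|j ne].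
  by rewrite addr0 !mxE eqxx mulr1.
by rewrite !mxE (negPf ne) mulr0.
Qed.

Lemma embTK S : (emb S)^T *m emb S = 1%:M.
Proof.
rewrite embTE; apply/matrixP => s t.
by rewrite !mxE (inj_eq enum_val_inj).
Qed.

Lemma embK S : emb S *m (emb S)^T = pr S.
Proof.
apply/matrixP => i j; rewrite !mxE; case: (boolP (i \in S)) => iS.
  rewrite (bigD1 (enum_rank_in iS i)) //= big1 => [|s ne].
    by rewrite addr0 !mxE enum_rankK_in // eqxx mul1r andbT eq_sym.
  rewrite !mxE; case: eqP => [ei|_]; last by rewrite mul0r.
  by case/eqP: ne; apply: enum_val_inj; rewrite enum_rankK_in.
rewrite andbF big1 // => s _; rewrite !mxE; case: eqP => [ei|_]; last by rewrite mul0r.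
by rewrite ei enum_valP in iS.
Qed.

Lemma pr_emb S : pr S *m emb S = emb S.
Proof. by rewrite -embK -mulmxA embTK mulmx1. Qed.

Lemma embT_pr S : (emb S)^T *m pr S = (emb S)^T.
Proof. by rewrite -embK mulmxA embTK mul1mx. Qed.

Lemma rsub_eq0 l S (N : 'M[K]_(n, l)) : (rsub S N == 0) = (pr S *m N == 0).
Proof.
rewrite -embTE -embK -mulmxA; apply/eqP/eqP => [->|h]; first by rewrite mulmx0.
by rewrite -[LHS]mul1mx -(embTK S) -mulmxA h mulmx0.
Qed.

Lemma graded_pr S (G : 'I_n -> deg d) : graded G G (pr S).
Proof.
move=> i j; rewrite mxE; case: eqP => // ->.
by rewrite ledeg_refl.
Qed.

Lemma graded_emb S (G : 'I_n -> deg d) : graded G (degs S G) (emb S).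
Proof.
move=> i s; rewrite mxE; case: eqP => // ->.
by rewrite /degs ledeg_refl.
Qed.

Lemma graded_embT S (G : 'I_n -> deg d) : graded (degs S G) G (emb S)^T.
Proof.
move=> s i; rewrite !mxE; case: eqP => // ->.
by rewrite /degs ledeg_refl.
Qed.

End Projections.

Arguments graded_pr {K d n} S G.
Arguments graded_emb {K d n} S G.
Arguments graded_embT {K d n} S G.

Lemma setrowsE (K : fieldType) m k (S : {set 'I_m}) (X : 'M[K]_(#|S|, k)) N :
  setrows X N = emb K S *m X + (N - pr K S *m N).
Proof.
apply/matrixP => i j; rewrite [LHS]mxE [RHS]mxE [X in _ = _ + X]mxE.
rewrite [X in _ = _ + (_ + X)]mxE pr_mull [X in _ = X + _]mxE.
case: pickP => [s /eqP <-|h].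
  rewrite enum_valP subrr addr0 (bigD1 s) //= big1 => [|t ne].
    by rewrite mxE eqxx mul1r addr0.
  by rewrite mxE (inj_eq enum_val_inj) eq_sym (negPf ne) mul0r.
case: ifP => iS; first by have := h (enum_rank_in iS i); rewrite enum_rankK_in ?eqxx.
rewrite subr0 big1 ?add0r // => s _; rewrite mxE.
by case: eqP => [ei|_]; [rewrite ei enum_valP in iS | rewrite mul0r].
Qed.

Section Corners.

Variables (K : fieldType) (d m r : nat) (G : 'I_m -> deg d) (R : 'I_r -> deg d).
Variables (A : 'M[K]_(m, r)) (b : block m r).
Local Notation p := (pr K b.1).
Local Notation F := (emb K b.1).
Local Notation H := (emb K b.2).

(** Rows and columns of the block see no entries outside it, so the diagonal
    projection onto its rows is an endomorphism of the presentation. *)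
Definition cut := p *m A = A *m pr K b.2.

(** Indecomposability or vanishing of the cokernel of a block, expressed by
    idempotents of the whole presentation. *)
Definition corner_indec := forall q, endo G R A q ->
  p *m q = q -> q *m p = q -> q *m q = q -> nul R A G q \/ nul R A G (p - q).

Lemma block_submxE : submx b A = F^T *m A *m H.
Proof. by rewrite embTE mul_embE; apply/matrixP => i j; rewrite !mxE. Qed.

Hypothesis cutA : cut.

(** Relations of the block and relations of the whole presentation agree on
    the rows of the block. *)
Lemma nul_submx l (D : 'I_l -> deg d) X :
  nul (degs b.2 R) (submx b A) D X <-> nul R A D (F *m X).
Proof.
split=> [[U hU ->]|[U hU e]].
  exists (H *m U); first by apply: gradedM hU; apply: graded_emb.
  by rewrite block_submxE !mulmxA embK cutA -!mulmxA; congr (_ *m _); rewrite mulmxA pr_emb.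
exists (H^T *m U); first by apply: gradedM hU; apply: graded_embT.
rewrite -[X]mul1mx -(embTK K b.1) -mulmxA e block_submxE -!mulmxA (mulmxA H) embK.
by rewrite (mulmxA A) -cutA !mulmxA embT_pr.
Qed.

Lemma endo_submx q : q *m p = q -> p *m q = q -> endo G R A q ->
  endo (degs b.1 G) (degs b.2 R) (submx b A) (F^T *m q *m F).
Proof.
move=> qp pq [gq [P gP eP]]; split.
  exact: gradedM (gradedM (graded_embT b.1 G) gq) (graded_emb b.1 G).
have gX : graded (degs b.2 R) (degs b.2 R) (H^T *m P *m H).
  exact: gradedM (gradedM (graded_embT b.2 R) gP) (graded_emb b.2 R).
exists (H^T *m P *m H) => //; rewrite block_submxE.
rewrite -!mulmxA (mulmxA F) embK (mulmxA q) qp (mulmxA q) eP !mulmxA.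
by rewrite -[F^T in LHS]embT_pr -!mulmxA (mulmxA p A) cutA -embK !mulmxA.
Qed.

Lemma endo_of_submx q : endo (degs b.1 G) (degs b.2 R) (submx b A) q ->
  endo G R A (F *m q *m F^T).
Proof.
move=> [gq [P gP eP]]; split.
  exact: gradedM (gradedM (graded_emb b.1 G) gq) (graded_embT b.1 G).
exists (H *m P *m H^T).
  exact: gradedM (gradedM (graded_emb b.2 R) gP) (graded_embT b.2 R).
have -> : F *m q *m F^T *m A = F *m (q *m submx b A) *m H^T.
  by rewrite block_submxE -[F^T in LHS]embT_pr -!mulmxA cutA -embK !mulmxA.
by rewrite eP block_submxE !mulmxA embK cutA -!mulmxA !(mulmxA (pr K b.2)) pr_emb.
Qed.

Lemma coker_submx_zeroP :
  gmzero (coker (degs b.1 G) (degs b.2 R) (submx b A)) <-> nul R A G p.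
Proof.
split=> [/coker_zeroP/nul_submx h|h].
  have -> : p = F *m 1%:M *m F^T by rewrite mulmx1 embK.
  by apply: nul_mulr h _; apply: graded_embT.
apply/coker_zeroP/nul_submx; rewrite mulmx1 -pr_emb.
by apply: nul_mulr h _; apply: graded_emb.
Qed.

Lemma corner_of_indecomposable :
  indecomposable (coker (degs b.1 G) (degs b.2 R) (submx b A)) -> corner_indec.
Proof.
move=> ind q eq pq qp qq.
have FqF : F *m (F^T *m q *m F) *m F^T = q.
  by rewrite !mulmxA embK -!mulmxA embK qp pq.
have idq : (F^T *m q *m F) *m (F^T *m q *m F) = F^T *m q *m F.
  by rewrite -!mulmxA (mulmxA F F^T) embK (mulmxA p) pq (mulmxA q) qq.
case: (idempotent_of_indecomposable ind (endo_submx qp pq eq) idq) => /nul_submx h.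
  by left; rewrite -FqF; apply: nul_mulr h _; apply: graded_embT.
right; have -> : p - q = F *m (1%:M - F^T *m q *m F) *m F^T.
  by rewrite mulmxBr mulmx1 mulmxBl FqF embK.
by apply: nul_mulr h _; apply: graded_embT.
Qed.

End Corners.

Lemma split_of_corner (K : finFieldType) d m r (G : 'I_m -> deg d) (R : 'I_r -> deg d)
    (A : 'M[K]_(m, r)) b :
  graded G R A -> cut A b -> corner_indec G R A b ->
  forall Y Z, gmiso (coker (degs b.1 G) (degs b.2 R) (submx b A)) (dsum Y Z) ->
  gmzero Y \/ gmzero Z.
Proof.
move=> gA cutA ci; apply: split_of_idempotents => [|q eq qq].
  by move=> i j hij; rewrite mxE gA.
pose F := emb K b.1.
have pF : pr K b.1 *m F = F by apply: pr_emb.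
have Fp : F^T *m pr K b.1 = F^T by apply: embT_pr.
have FK : F^T *m F = 1%:M by apply: embTK.
case: (ci _ (endo_of_submx cutA eq)).
- by rewrite !mulmxA pF.
- by rewrite -!mulmxA Fp.
- by rewrite -!mulmxA (mulmxA F^T F) FK mul1mx (mulmxA q q) qq.
- move=> h; left; apply/(nul_submx _ cutA).
  have -> : F *m q = F *m q *m F^T *m F by rewrite -!mulmxA FK mulmx1.
  by apply: nul_mulr h _; apply: graded_emb.
move=> h; right; apply/(nul_submx _ cutA).
have -> : F *m (1%:M - q) = (pr K b.1 - F *m q *m F^T) *m F.
  by rewrite mulmxBl pF -!mulmxA FK mulmx1 mulmxBr mulmx1.
by apply: nul_mulr h _; apply: graded_emb.
Qed.

(** * The exchange property *)

Section BlockProjections.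

Variables (K : fieldType) (m r : nat) (M : 'M[K]_(m, r)) (B0 : {set block m r}).
Hypothesis bd : block_decomposed B0 M.
Implicit Types (b c : block m r) (B : {set block m r}).
Local Notation pb b := (pr K b.1).
Local Notation pB B := (pr K (join B).1).

Lemma row_block b c i : b \in B0 -> c \in B0 -> i \in b.1 -> i \in c.1 -> b = c.
Proof.
by case: bd => h _ _ bB cB ib ic; have [x [_ u]] := h i; rewrite -(u b) // -(u c).
Qed.

Lemma col_block b c j : b \in B0 -> c \in B0 -> j \in b.2 -> j \in c.2 -> b = c.
Proof.
by case: bd => _ h _ bB cB ib ic; have [x [_ u]] := h j; rewrite -(u b) // -(u c).
Qed.

Lemma joinP1 B i : reflect (exists2 b, b \in B & i \in b.1) (i \in (join B).1).
Proof. exact: bigcupP. Qed.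

Lemma joinP2 B j : reflect (exists2 b, b \in B & j \in b.2) (j \in (join B).2).
Proof. exact: bigcupP. Qed.

Lemma join_row B b i : B \subset B0 -> b \in B0 -> i \in b.1 ->
  (i \in (join B).1) = (b \in B).
Proof.
move=> /subsetP sB bB ib; apply/joinP1/idP => [[c cB ic]|]; last by exists b.
by rewrite (row_block bB (sB c cB) ib ic).
Qed.

Lemma join_col B b j : B \subset B0 -> b \in B0 -> j \in b.2 ->
  (j \in (join B).2) = (b \in B).
Proof.
move=> /subsetP sB bB ib; apply/joinP2/idP => [[c cB ic]|]; last by exists b.
by rewrite (col_block bB (sB c cB) ib ic).
Qed.

Lemma cut_join B : B \subset B0 -> cut M (join B).
Proof.
move=> sB; apply/matrixP => i j; rewrite pr_mull pr_mulr.
have [->|/eqP nz] := eqVneq (M i j) 0; first by case: ifP; case: ifP.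
have [_ _ h] := bd; have [b [bB ib jb]] := h i j (introN eqP nz).
by rewrite (join_row sB bB ib) (join_col sB bB jb).
Qed.

Lemma join1 b : join [set b] = b.
Proof. by rewrite /join !big_set1; case: b. Qed.

Lemma cut_block b : b \in B0 -> cut M b.
Proof. by move=> bB; rewrite -(join1 b); apply: cut_join; rewrite sub1set. Qed.

Lemma pb_pB B b : b \in B -> pb b *m pB B = pb b.
Proof. by move=> bB; rewrite pr_mul (setIidPl _) // (bigcup_sup b). Qed.

Lemma pB_pb B b : b \in B -> pB B *m pb b = pb b.
Proof. by move=> bB; rewrite pr_mul (setIidPr _) // (bigcup_sup b). Qed.

Lemma pb_pb0 b c : b \in B0 -> c \in B0 -> b != c -> pb b *m pb c = 0.
Proof.
move=> bB cB bc; rewrite pr_mul (_ : _ :&: _ = set0) ?pr0 //; apply/setP => i.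
rewrite !inE; apply/negP => /andP[ib ic].
by rewrite (row_block bB cB ib ic) eqxx in bc.
Qed.

Lemma pB_sum B : B \subset B0 -> pB B = \sum_(b in B) pb b.
Proof.
move=> sB; apply/matrixP => i j; rewrite summxE !mxE.
case: joinP1 => [[b bB ib]|nB].
  rewrite (bigD1 b) //= big1 => [|c /andP[cB ne]]; first by rewrite !mxE ib addr0.
  rewrite mxE; case: (boolP (i \in c.1)) => ic; last by rewrite andbF.
  by rewrite (row_block (subsetP sB _ bB) (subsetP sB _ cB) ib ic) eqxx in ne.
rewrite andbF big1 // => b bB; rewrite mxE; case: (boolP (i \in b.1)) => ib.
  by case: nB; exists b.
by rewrite andbF.
Qed.

Lemma pB_setD B B1 : B \subset B0 -> B1 \subset B -> pB (B :\: B1) = pB B - pB B1.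
Proof.
move=> sB sB1; rewrite !pB_sum ?(subset_trans sB1) ?(subset_trans (subsetDl _ _)) //.
rewrite [in RHS](big_setID B1) /= (setIidPr sB1) addrC addrK //.
Qed.

Lemma pB_disjoint B (C : {set block m r}) :
  B \subset B0 -> C \subset B0 -> [disjoint B & C] -> pB B *m pB C = 0.
Proof.
move=> sB sC dis; rewrite pr_mul (_ : _ :&: _ = set0) ?pr0 //; apply/setP => i.
rewrite !inE; apply/negP => /andP[/joinP1[b bB ib]].
by rewrite (join_row sC (subsetP sB b bB) ib) (disjointFr dis bB).
Qed.

End BlockProjections.

Section Clearing.

Variables (K : finFieldType) (d m r : nat).
Variables (G : 'I_m -> deg d) (R : 'I_r -> deg d) (alpha : deg d).
Variables (M : 'M[K]_(m, r)) (B0 : {set block m r}).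
Hypothesis bd : block_decomposed B0 M.
Hypothesis ci : forall b, b \in B0 -> corner_indec G R M b.
Implicit Types (b c : block m r) (B : {set block m r}).
Local Notation pb b := (pr K b.1).
Local Notation pB B := (pr K (join B).1).
Local Notation nula := (nul R M (fun=> alpha)).
Local Notation nulG := (nul R M G).
Local Notation isendo := (endo G R M).

Lemma endo_pB B : B \subset B0 -> isendo (pB B).
Proof.
move=> sB; split; first exact: graded_pr.
by exists (pr K (join B).2); [apply: graded_pr | apply: (cut_join bd)].
Qed.

Lemma endo_pb b : b \in B0 -> isendo (pb b).
Proof. by move=> bB; rewrite -(join1 b); apply: endo_pB; rewrite sub1set. Qed.

(** The identity on [b] together with row additions from other blocks to [b],
    such that all rows of [b] become relations. *)
Definition clearable b l (N : 'M[K]_(m, l)) := exists chi,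
  [/\ isendo chi, pb b *m chi = chi, chi *m pb b = pb b & nula (chi *m N)].

Section Annihilator.

Variables (B : {set block m r}) (l : nat) (N : 'M[K]_(m, l)).
Hypotheses (sB : B \subset B0) (gN : graded G (fun=> alpha) N).
Hypothesis ncl : forall b, b \in B -> ~ clearable b N.
Local Notation p := (pB B).

(** A left ideal of the corner ring of [B]: the endomorphisms that kill
    [N]. *)
Definition annih phi := [/\ isendo phi, p *m phi = phi, phi *m p = phi & nula (phi *m N)].

(** One step of Gaussian elimination on [p - phi]. The pivot is
    [p_b - p_b phi p_b]. The idempotent power of [p_b phi p_b] is [nul] or the
    identity of the block; the second would make [b] clearable, so the first
    holds, [p_b phi p_b] is nilpotent up to [nul], and the pivot is inverted by
    a geometric sum. Only left multiples of [phi] are subtracted,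
    so the result stays in the ideal. *)
Lemma annih_step b phi : b \in B -> annih phi ->
  exists phi' g, [/\ annih phi', (p - phi) *m g = p - phi', nulG (pb b *m phi')
    & forall c, c \in B0 -> c != b -> nulG (pb c *m phi) -> nulG (pb c *m phi')].
Proof.
move=> bB [ephi pphi phip nphi]; have bB0 := subsetP sB b bB.
have epb := endo_pb bB0.
have [x xE] : exists x, x = pb b *m phi *m pb b by eexists.
have pbx : pb b *m x = x by rewrite xE !mulmxA prK.
have xpb : x *m pb b = x by rewrite xE -!mulmxA prK.
have ex : isendo x by rewrite xE; apply: endoM => //; apply: endoM.
have [n n0 idx] := idempotent_power x; have exn := endoX n ex.
have pbxn : pb b *m x ^+ n = x ^+ n.
  by case: n n0 {idx exn} => // n _; rewrite exprS -mulmxE mulmxA pbx.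
have xnpb : x ^+ n *m pb b = x ^+ n.
  by case: n n0 {idx exn pbxn} => // n _; rewrite exprSr -mulmxE -mulmxA xpb.
case: (ci bB0 exn pbxn xnpb idx) => [nx|nx]; last first.
  (* The second summand makes this the identity on [b], not only up to
     [nul]. *)
  case: (ncl bB); exists (pb b *m x ^+ n.-1 *m phi + (pb b - x ^+ n)).
  have pbx1 : pb b *m x ^+ n.-1 *m pb b = pb b *m x ^+ n.-1.
    case: (n.-1) => [|s]; first by rewrite expr0 mulmx1 prK.
    by rewrite exprSr -mulmxE -!mulmxA xpb.
  have e1 : isendo (pb b *m x ^+ n.-1) by apply: endoM => //; exact: endoX.
  split.
  - by apply: endoD; [apply: endoM | apply: endoB].
  - by rewrite mulmxDr !mulmxA prK mulmxBr prK pbxn.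
  - rewrite mulmxDl mulmxBl prK xnpb -pbx1 -!mulmxA (mulmxA (pb b) phi) -xE.
    rewrite mulmxE -exprSr prednK // -mulmxE pbxn addrC subrK //.
  - rewrite mulmxDl; apply: nulD; last exact: nul_mulr nx gN.
    by rewrite -mulmxA; apply: nul_endol e1 nphi.
(* The pivot [p_b - x] is inverted by [v] up to [x ^+ n], which is [nul]. *)
pose S := \sum_(i < n) x ^+ i.
have [v vE] : exists v, v = pb b *m S by eexists.
have ev : isendo v.
  by rewrite vE; apply: endoM => //; apply: endo_sum => i _; exact: (endoX i ex).
have pv : p *m v = v by rewrite vE mulmxA pB_pb.
(* These are chosen to make [(p - phi) (p + v phi) = p - phi'] an identity. *)
exists (phi - v *m phi + phi *m v *m phi), (p + v *m phi); split.
- split.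
  + apply: endoD; first by apply: endoB => //; apply: endoM.
    by do 2?apply: endoM => //.
  + by rewrite mulmxDr mulmxBr !mulmxA pv pphi.
  + by rewrite mulmxDl mulmxBl -!mulmxA phip.
  + rewrite mulmxDl mulmxBl -!mulmxA; apply: nulD; first apply: nulB => //.
      exact: nul_endol ev nphi.
    by apply: (nul_endol ephi); apply: nul_endol ev nphi.
- rewrite mulmxDr !mulmxBl prK phip !mulmxA pv opprD opprB addrACA.
  by rewrite [in RHS]addrA [in RHS]addrA -!addrA; congr (_ + _); rewrite addrCA.
- suff -> : pb b *m (phi - v *m phi + phi *m v *m phi) = x ^+ n *m phi.
    exact: nul_mulr nx ephi.1.
  have e : (pb b - x) *m v = pb b - x ^+ n.
    rewrite vE mulmxA mulmxBl prK xpb.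
    have -> : pb b - x = pb b *m (1%:M - x) by rewrite mulmxBr mulmx1 pbx.
    rewrite -mulmxA.
    have -> : (1%:M - x) *m S = 1%:M - x ^+ n.
      by apply: oppr_inj; rewrite -mulNmx !opprB mulmxE subrX1.
    by rewrite mulmxBr mulmx1 pbxn.
  have e' : x *m v = pb b *m phi *m v.
    by rewrite vE xE -!mulmxA (mulmxA (pb b) (pb b)) prK.
  have pbv : pb b *m v = v by rewrite vE !mulmxA prK.
  rewrite mulmxDr mulmxBr !mulmxA pbv -e'.
  have -> : pb b *m phi - v *m phi + x *m v *m phi = (pb b - (pb b - x) *m v) *m phi.
    by rewrite (mulmxBl (pb b) x) pbv !mulmxBl opprB addrA addrAC.
  by rewrite e opprB addrC subrK.
move=> c cB cb nc; rewrite mulmxDr mulmxBr !mulmxA.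
have -> : pb c *m v = 0 by rewrite vE mulmxA (pb_pb0 bd) ?mul0mx.
rewrite mul0mx subr0; apply: nulD => //; rewrite -mulmxA.
by apply: nul_mulr nc _; apply: (endoM ev ephi).1.
Qed.

Lemma annih_kill (s : seq (block m r)) phi : {subset s <= B} -> annih phi ->
  exists phi' g, [/\ annih phi', (p - phi) *m g = p - phi'
    & forall b, b \in s -> nulG (pb b *m phi')].
Proof.
elim: s => [_ aphi|b s IHs sbB aphi].
  have [_ pphi phip _] := aphi; exists phi, p; split=> //.
  by rewrite mulmxBl prK phip.
have bB : b \in B by apply: sbB; rewrite mem_head.
have [phi1 [g1 [a1 e1 h1]]] : exists phi' g, [/\ annih phi', (p - phi) *m g = p - phi'
    & forall b, b \in s -> nulG (pb b *m phi')].
  by apply: IHs => // c cs; apply: sbB; rewrite inE cs orbT.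
have [phi2 [g2 [a2 e2 hb hc]]] := annih_step bB a1.
exists phi2, (g1 *m g2); split=> // [|c]; first by rewrite mulmxA e1.
rewrite inE; case: (eqVneq c b) => [-> //|cb] /= cs.
by apply: hc => //; [apply/(subsetP sB)/sbB; rewrite inE cs orbT | apply: h1].
Qed.

(** If no single block can be cleared, no direct summand can: this is the
    exchange property behind the Krull-Schmidt theorem. Elimination over all
    blocks gives [(p - h) g = p] up to [nul], and [h (p - h) = 0]. *)
Lemma idempotent_annih_nul h : annih h -> h *m h = h -> nulG h.
Proof.
move=> ah hh; have [eh ph hp nh] := ah.
have [phi [g [[ephi pphi _ _] e hb]]] := annih_kill (s := enum B) (phi := h)
  (fun b => etrans (esym (mem_enum B b))) ah.
have nphi : nulG phi.
  rewrite -pphi (pB_sum bd sB) mulmx_suml.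
  apply: (big_ind (nulG)) => [||b bB]; [exact: nul0|by move=> *; apply: nulD|].
  by apply: hb; rewrite mem_enum.
have := congr1 (mulmx h) e; rewrite mulmxA mulmxBr hp hh subrr mul0mx mulmxBr hp.
move/esym/subr0_eq => ->; exact: nul_endol eh nphi.
Qed.

End Annihilator.

End Clearing.

(** * Subspaces listed by Dec *)

Section DecTheory.

Variable K : finFieldType.

Lemma mem_colspaceP k l (T : 'M[K]_(k, l)) v :
  v \in colspace T <-> exists u, v = T *m u.
Proof.
split=> [/span_lines_mem[a ->]|[u ->]].
  exists (\col_j a j); rewrite mulmx_sum_col; apply: eq_bigr => j _.
  by rewrite mxE.
apply/span_lines_mem; exists (fun j => u j 0); exact: mulmx_sum_col.
Qed.

Lemma colspace_sub k l l' (T : 'M[K]_(k, l)) (T' : 'M[K]_(k, l')) :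
  (colspace T <= colspace T')%VS -> exists C, T = T' *m C.
Proof.
move=> sTT'; have/fin_all_exists[C hC] : forall j, exists u, col j T = T' *m u.
  move=> j; apply/mem_colspaceP/(subvP sTT')/mem_colspaceP.
  by exists (delta_mx j 0); rewrite colE.
exists (\matrix_(i, j) C j i 0); apply/matrixP => i j.
have /colP/(_ i) := hC j; rewrite !mxE => ->.
by apply: eq_bigr => s _; rewrite mxE.
Qed.

Lemma dec_invertible k s (t : splitmx K k) : is_dec s -> t \in s ->
  [/\ (0 < tag t)%N, (2 * tag t <= k)%N &
   exists S1 S2, [/\ sp1 t *m S1 + sp2 t *m S2 = 1%:M,
    S1 *m sp1 t = 1%:M, S1 *m sp2 t = 0, S2 *m sp1 t = 0 & S2 *m sp2 t = 1%:M]].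
Proof.
move=> [h _ _] /h[t0 tk _ /andP[fr fu] _]; split=> //.
pose X := pinvmx (row_mx (sp1 t) (sp2 t)).
have XT : X *m row_mx (sp1 t) (sp2 t) = 1%:M by apply: mulVpmx.
have TX : row_mx (sp1 t) (sp2 t) *m X = 1%:M by apply: mulmxVp.
exists (usubmx X), (dsubmx X); move: XT TX.
rewrite -{1 2}[X]vsubmxK mul_row_col mul_col_row scalar_mx_block => /eq_block_mx[-> -> -> ->].
by move=> ->.
Qed.

Lemma complementary_dim k (W : 'M[K]_k) : W *m W = W ->
  (\dim (colspace W) + \dim (colspace (1%:M - W)) <= k)%N.
Proof.
move=> WW; rewrite -dimv_disjoint_sum.
  by rewrite (leq_trans (dimvS (subvf _))) // dimvf /dim /= muln1.
apply/eqP; rewrite -subv0; apply/subvP => v /memv_capP[].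
move=> /mem_colspaceP[u ->] /mem_colspaceP[w e]; rewrite memv0.
by rewrite -WW -mulmxA e mulmxA mulmxBr mulmx1 WW subrr mul0mx.
Qed.

(** The first unit vector is the sum of its two components. *)
Lemma complementary_first_pivot k (W : 'M[K]_k) : (0 < k)%N ->
  first_pivot (colspace W) \/ first_pivot (colspace (1%:M - W)).
Proof.
case: k W => // k W _.
have piv (V : 'M[K]_k.+1) :
    (V *m delta_mx ord0 (0 : 'I_1)) ord0 0 != 0 -> first_pivot (colspace V).
  move=> nz; apply/existsP; exists ord0; rewrite eqxx andbT inE; apply/existsP.
  exists (V *m delta_mx ord0 0); rewrite nz /= andbC; apply/andP; split.
    exact/forallP.
  by apply/mem_colspaceP; eexists.
have e : (W *m delta_mx ord0 (0 : 'I_1)) ord0 0 +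
         ((1%:M - W) *m delta_mx ord0 (0 : 'I_1)) ord0 0 = 1.
  transitivity (((W + (1%:M - W)) *m delta_mx ord0 (0 : 'I_1)) ord0 0).
    by rewrite [in RHS]mulmxDl [RHS]mxE.
  by rewrite addrC subrK mul1mx mxE !eqxx.
case: (eqVneq ((W *m delta_mx ord0 (0 : 'I_1)) ord0 0) 0) => [z|nz].
  by right; apply: piv; apply/eqP => z'; move/eqP: e; rewrite z z' addr0 eq_sym oner_eq0.
by left; apply: piv.
Qed.

(** Of two complementary subspaces, one has dimension at most [k / 2]; if both
    have dimension [k / 2], one of them has a vector with nonzero first
    entry. *)
Lemma dec_choice k (s : seq (splitmx K k)) (W : 'M[K]_k) : is_dec s ->
  W *m W = W -> W != 0 -> W != 1%:M ->
  exists2 t, t \in s & exists C,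
    (W = sp1 t *m C /\ W *m sp1 t = sp1 t) \/
    (1%:M - W = sp1 t *m C /\ (1%:M - W) *m sp1 t = sp1 t).
Proof.
move=> [_ _ h] WW W0 W1.
have k0 : (0 < k)%N.
  by case: k s h W {WW W1} W0 => // s _ W /eqP[]; apply/matrixP => -[].
have use (V : 'M[K]_k) : V *m V = V -> V != 0 -> (2 * \dim (colspace V) <= k)%N ->
    ((2 * \dim (colspace V))%N = k -> first_pivot (colspace V)) ->
    exists2 t, t \in s & exists C, V = sp1 t *m C /\ V *m sp1 t = sp1 t.
  move=> VV V0 dk fp; have [|t [[ts et] _]] := h (colspace V) _ dk fp.
    rewrite lt0n dimv_eq0; apply: contraNneq V0 => V0; apply/eqP/matrixP => i j.
    have : col j V \in colspace V.
      by apply/mem_colspaceP; exists (delta_mx j 0); rewrite colE.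
    by rewrite V0 memv0 => /eqP/colP/(_ i); rewrite !mxE.
  have [C eC] : exists C, V = sp1 t *m C by apply: colspace_sub; rewrite et.
  have [C' eC'] : exists C, sp1 t = V *m C by apply: colspace_sub; rewrite et.
  by exists t => //; exists C; split=> //; rewrite eC' mulmxA VV.
have WW' : (1%:M - W) *m (1%:M - W) = 1%:M - W.
  by rewrite mulmxBr mulmx1 mulmxBl mul1mx WW subrr subr0.
have W0' : 1%:M - W != 0 by rewrite subr_eq0 eq_sym.
have dd := complementary_dim WW.
have useW : (2 * \dim (colspace W) <= k)%N ->
    ((2 * \dim (colspace W))%N = k -> first_pivot (colspace W)) ->
    exists2 t, t \in s & exists C, (W = sp1 t *m C /\ W *m sp1 t = sp1 t) \/
    (1%:M - W = sp1 t *m C /\ (1%:M - W) *m sp1 t = sp1 t).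
  by move=> dk fp; have [t ts [C e]] := use W WW W0 dk fp; exists t => //; exists C; left.
have useW' : (2 * \dim (colspace (1%:M - W)) <= k)%N ->
    ((2 * \dim (colspace (1%:M - W)))%N = k -> first_pivot (colspace (1%:M - W))) ->
    exists2 t, t \in s & exists C, (W = sp1 t *m C /\ W *m sp1 t = sp1 t) \/
    (1%:M - W = sp1 t *m C /\ (1%:M - W) *m sp1 t = sp1 t).
  by move=> dk fp; have [t ts [C e]] := use _ WW' W0' dk fp; exists t => //; exists C; right.
case: (ltngtP (2 * \dim (colspace W)) k) => [lt|gt|eq].
- by apply: useW => [|e]; [apply: ltnW | rewrite e ltnn in lt].
- have lt : (2 * \dim (colspace (1%:M - W)) < k)%N by lia.
  by apply: useW' => [|e]; [apply: ltnW | rewrite e ltnn in lt].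
have [fp|fp] := complementary_first_pivot W k0.
  by apply: useW; rewrite ?eq.
by apply: useW' => //; lia.
Qed.

End DecTheory.

(** * What BlockReduce and the joint reduction compute *)

Section Homs.

Variables (K : fieldType) (d m r : nat) (G : 'I_m -> deg d) (R : 'I_r -> deg d).
Variables (M : 'M[K]_(m, r)) (b c : block m r).
Hypotheses (cutb : cut M b) (cutc : cut M c).

(** Morphisms between blocks are endomorphisms of the whole presentation that
    vanish elsewhere. *)
Lemma endo_of_hom (Q : 'M_(#|b.1|, #|c.1|)) (P : 'M_(#|b.2|, #|c.2|)) :
  graded (degs b.1 G) (degs c.1 G) Q -> graded (degs b.2 R) (degs c.2 R) P ->
  Q *m submx c M + submx b M *m P = 0 ->
  endo G R M (emb K b.1 *m Q *m (emb K c.1)^T).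
Proof.
move=> gQ gP /eqP; rewrite addr_eq0 => /eqP e; split.
  exact: gradedM (gradedM (graded_emb b.1 G) gQ) (graded_embT c.1 G).
exists (- (emb K b.2 *m P *m (emb K c.2)^T)).
  apply: gradedN; exact: gradedM (gradedM (graded_emb b.2 R) gP) (graded_embT c.2 R).
have -> : emb K b.1 *m Q *m (emb K c.1)^T *m M =
    emb K b.1 *m (Q *m submx c M) *m (emb K c.2)^T.
  by rewrite block_submxE -[(emb K c.1)^T in LHS]embT_pr -!mulmxA cutc -embK !mulmxA.
rewrite e block_submxE mulmxN mulNmx mulmxN; congr (- _).
by rewrite !mulmxA embK cutb -!mulmxA !(mulmxA (pr K b.2)) pr_emb.
Qed.

Lemma hom_of_endo chi P : chi *m M = M *m P ->
  ((emb K b.1)^T *m chi *m emb K c.1) *m submx c M +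
  submx b M *m (- ((emb K b.2)^T *m P *m emb K c.2)) = 0.
Proof.
move=> e; rewrite mulmxN; apply/eqP; rewrite subr_eq0 !block_submxE; apply/eqP.
rewrite -!mulmxA (mulmxA (emb K c.1)) embK (mulmxA (pr K c.1) M) cutc.
rewrite -(mulmxA M) pr_emb (mulmxA chi) e.
rewrite (mulmxA (emb K b.2)) embK (mulmxA M (pr K b.2)) -cutb.
by rewrite -!mulmxA (mulmxA _ (pr K b.1)) embT_pr.
Qed.

End Homs.

Section Automorphisms.

Variables (K : fieldType) (d m r : nat) (G : 'I_m -> deg d) (R : 'I_r -> deg d).
Variables (M : 'M[K]_(m, r)).
Implicit Types S T : {set 'I_m}.

(** Automorphisms of the presentation that change and use only the rows in
    [S]; those for disjoint sets of rows do not interfere. *)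
Definition aut S psi := [/\ endo G R M psi,
  pr K S *m (psi - 1%:M) = psi - 1%:M, (psi - 1%:M) *m pr K S = psi - 1%:M
  & exists psi', [/\ endo G R M psi', psi *m psi' = 1%:M & psi' *m psi = 1%:M]].

Lemma aut1 S : aut S 1%:M.
Proof.
split; rewrite ?subrr ?mulmx0 ?mul0mx //; first exact: endo1.
by exists 1%:M; rewrite mulmx1; split=> //; apply: endo1.
Qed.

Lemma autM S psi phi : aut S psi -> aut S phi -> aut S (psi *m phi).
Proof.
move=> [epsi psi1 psi2 [psi' [epsi' e1 e2]]] [ephi phi1 phi2 [phi' [ephi' f1 f2]]].
rewrite /aut; have -> : psi *m phi - 1%:M =
    (psi - 1%:M) *m (phi - 1%:M) + (psi - 1%:M) + (phi - 1%:M).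
  by rewrite mulmxBr mulmx1 subrK mulmxBl mul1mx addrA subrK.
split; first exact: endoM.
- by rewrite 2!mulmxDr mulmxA psi1 phi1.
- by rewrite 2!mulmxDl -mulmxA psi2 phi2.
exists (phi' *m psi'); split; first exact: endoM.
  by rewrite -mulmxA (mulmxA phi) f1 mul1mx.
by rewrite -mulmxA (mulmxA psi') e2 mul1mx.
Qed.

Lemma autS S T psi : S \subset T -> aut S psi -> aut T psi.
Proof.
move=> ST [epsi p1 p2 h]; split=> //.
  by rewrite -p1 mulmxA pr_mul (setIidPr ST).
by rewrite -p2 -mulmxA pr_mul (setIidPl ST).
Qed.

Lemma aut_comm S psi : aut S psi -> psi *m pr K S = pr K S *m psi.
Proof.
case=> _ h1 h2 _; rewrite -[psi](subrK 1%:M) mulmxDl mulmxDr h1 h2.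
by rewrite mul1mx mulmx1.
Qed.

Lemma aut_id S psi l (X : 'M[K]_(m, l)) : aut S psi -> pr K S *m X = 0 -> psi *m X = X.
Proof.
case=> _ _ h _ X0; apply/eqP; rewrite -subr_eq0 -[X in _ - X]mul1mx -mulmxBl -h.
by rewrite -mulmxA X0 mulmx0.
Qed.

(** Row additions from some blocks to others square to zero, hence are
    invertible. *)
Lemma aut_shear S delta : endo G R M delta -> pr K S *m delta = delta ->
  delta *m pr K S = delta -> delta *m delta = 0 -> aut S (1%:M + delta).
Proof.
move=> ed d1 d2 dd; have e1 : endo G R M 1%:M by apply: endo1.
have e : 1%:M + delta - 1%:M = delta by rewrite addrAC subrr add0r.
split; rewrite ?e //; first exact: endoD.
exists (1%:M - delta); split; first exact: endoB.
  by rewrite mulmxDl mul1mx mulmxBr mulmx1 dd subr0 subrK.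
by rewrite mulmxBl mul1mx mulmxDr mulmx1 dd addr0 addrK.
Qed.

End Automorphisms.

Section Reductions.

Variables (K : finFieldType) (d m r : nat).
Variables (G : 'I_m -> deg d) (R : 'I_r -> deg d) (alpha : deg d).
Variables (M : 'M[K]_(m, r)) (B0 : {set block m r}).
Hypothesis bd : block_decomposed B0 M.
Implicit Types (b c : block m r) (B : {set block m r}).
Local Notation pb b := (pr K b.1).
Local Notation pB B := (pr K (join B).1).
Local Notation nula := (nul R M (fun=> alpha)).
Local Notation clearable := (clearable G R alpha M).
Local Notation aut B := (aut G R M (join B).1).
Local Notation ga := (graded G (fun=> alpha)).
Local Notation ra := (graded R (fun=> alpha)).

Lemma clearable_of_reduction B b l (N : 'M[K]_(m, l)) : B \subset B0 -> b \in B ->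
  pB B *m N = N -> clearable b N ->
  exists Q P U, @reduction _ _ _ _ G R alpha M B b l N Q P U.
Proof.
move=> sB bB pN [chi [[gchi [P gP eP]] pchi chip [U gU eU]]].
have cb := cut_block bd (subsetP sB b bB).
exists (fun c => (emb K b.1)^T *m chi *m emb K c.1).
exists (fun c => - ((emb K b.2)^T *m P *m emb K c.2)), (- ((emb K b.2)^T *m U)).
split.
- move=> c cB cb'; have cc := cut_block bd (subsetP sB c cB); split.
  + exact: gradedM (gradedM (graded_embT b.1 G) gchi) (graded_emb c.1 G).
  + by apply: gradedN; exact: gradedM (gradedM (graded_embT b.2 R) gP) (graded_emb c.2 R).
  + exact: hom_of_endo.
- by apply: gradedN; apply: gradedM gU; apply: graded_embT.
have -> : \sum_(c in B | c != b) (emb K b.1)^T *m chi *m emb K c.1 *m rsub c.1 N =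
    (emb K b.1)^T *m chi *m ((pB B - pb b) *m N).
  rewrite (pB_sum bd sB) (bigD1 b bB) /= addrC addrK mulmx_suml mulmx_sumr.
  by apply: eq_bigr => c _; rewrite -embTE -embK !mulmxA.
rewrite mulmxBl pN -mulmxA mulmxBr (mulmxA chi) chip eU mulmxBr.
rewrite (mulmxA _ (pr K b.1)) embT_pr -embTE [_ *m N + _]addrC subrK mulmxN block_submxE.
rewrite -!mulmxA (mulmxA (emb K b.2)) embK (mulmxA M) -cb !mulmxA embT_pr subrr //.
Qed.

(** The last clause makes one pass over the blocks enough: clearing a block
    never makes another block clearable. *)
Lemma block_reduceP B b l1 l2 (N1 : 'M[K]_(m, l1)) (N2 : 'M[K]_(m, l2)) N1' N2' :
  B \subset B0 -> b \in B -> pB B *m N1 = N1 -> pB B *m N2 = N2 ->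
  block_reduce G R alpha M B b N1 N2 N1' N2' ->
  [/\ exists psi U, [/\ aut B psi, ra U, N1' = psi *m N1 + M *m U & N2' = psi *m N2],
      pB B *m N1' = N1', pB B *m N2' = N2',
      pb b *m N1' = 0 \/ ~ clearable b N1'
    & forall c, c \in B -> pb c *m N1' = 0 \/
        (pb c *m N1' = pb c *m N1 /\ (clearable c N1' -> clearable c N1))].
Proof.
move=> sB bB pN1 pN2; case=> [Q P U [hQ gU eU]|keep]; last first.
  split=> //; last by right.
    exists 1%:M, 0; split; [exact: aut1|exact: graded0| |]; by rewrite mul1mx ?mulmx0 ?addr0.
  right => /(clearable_of_reduction sB bB pN1)[Q [P [U h]]].
  exact: keep h.
have bB0 := subsetP sB b bB; have cb := cut_block bd bB0.
pose delta := \sum_(c in B | c != b) emb K b.1 *m Q c *m (emb K c.1)^T.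
have ed : endo G R M delta.
  apply: endo_sum => c /andP[cB cb']; have [gQ gP e] := hQ c cB cb'.
  by apply: endo_of_hom e => //; apply: (cut_block bd); apply: (subsetP sB).
have bd' : pb b *m delta = delta.
  by rewrite mulmx_sumr; apply: eq_bigr => c _; rewrite !mulmxA pr_emb.
have d1 : pB B *m delta = delta by rewrite -bd' mulmxA pB_pb.
have d2 : delta *m pB B = delta.
  rewrite mulmx_suml; apply: eq_bigr => c /andP[cB _].
  by rewrite -[(emb K c.1)^T]embT_pr -!mulmxA (pb_pB _ cB).
have db : delta *m pb b = 0.
  rewrite mulmx_suml big1 // => c /andP[cB cb'].
  rewrite -[(emb K c.1)^T]embT_pr -!mulmxA (pb_pb0 bd) ?mulmx0 //.
  exact: (subsetP sB).
have dd : delta *m delta = 0 by rewrite -{2}bd' mulmxA db mul0mx.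
have dN l (N : 'M[K]_(m, l)) : delta *m N =
    emb K b.1 *m \sum_(c in B | c != b) Q c *m rsub c.1 N.
  rewrite mulmx_suml mulmx_sumr; apply: eq_bigr => c _.
  by rewrite -embTE !mulmxA.
have e1 : setrows (S := b.1) 0 N1 = (1%:M + delta) *m N1 + M *m (emb K b.2 *m U).
  rewrite setrowsE mulmx0 add0r mulmxDl mul1mx -addrA; congr (_ + _).
  have := congr1 (mulmx (emb K b.1)) eU.
  rewrite mulmx0 !mulmxDr -dN -embTE block_submxE !mulmxA embK cb.
  rewrite -(mulmxA M (pr K b.2)) pr_emb -addrA => /eqP.
  by rewrite addrC addr_eq0 => /eqP ->.
have p1 : pb b *m setrows (S := b.1) 0 N1 = 0.
  by rewrite setrowsE mulmx0 add0r mulmxBr mulmxA prK subrr.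
split=> //.
- exists (1%:M + delta), (emb K b.2 *m U); split=> //; first exact: aut_shear.
    by apply: gradedM gU; apply: graded_emb.
  rewrite setrowsE mulmxDr -dN -embTE mulmxA embK mulmxDl mul1mx.
  by rewrite addrC addrA subrK.
- by rewrite setrowsE mulmx0 add0r mulmxBr pN1 mulmxA pB_pb.
- rewrite setrowsE mulmxDr mulmxBr pN2 !mulmxA pB_pb //.
  by congr (_ *m _ + _); rewrite -pr_emb mulmxA pB_pb.
- by left.
move=> c cB; have [->|cb'] := eqVneq c b; first by left.
have p1' : setrows (S := b.1) 0 N1 = (1%:M - pb b) *m N1.
  by rewrite setrowsE mulmx0 add0r mulmxBl mul1mx.
have cB0 := subsetP sB c cB.
right; rewrite p1'; split.
  by rewrite mulmxA mulmxBr mulmx1 (pb_pb0 bd) // subr0.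
move=> [chi [echi h1 h2 h3]]; exists (chi *m (1%:M - pb b)); split.
- by apply: endoM => //; apply: endoB; [apply: endo1 | apply: endo_pb bd _ bB0].
- by rewrite mulmxA h1.
- by rewrite -mulmxA mulmxBl mul1mx (pb_pb0 bd) // 1?eq_sym // subr0 h2.
- by rewrite -mulmxA.
Qed.

Lemma reduce_allP B s l1 l2 (N1 : 'M[K]_(m, l1)) (N2 : 'M[K]_(m, l2)) N1' N2' :
  B \subset B0 -> {subset s <= B} ->
  reduce_all G R alpha M B s N1 N2 N1' N2' ->
  pB B *m N1 = N1 -> pB B *m N2 = N2 ->
  [/\ exists psi U, [/\ aut B psi, ra U, N1' = psi *m N1 + M *m U & N2' = psi *m N2],
      pB B *m N1' = N1', pB B *m N2' = N2',
      forall b, b \in s -> pb b *m N1' = 0 \/ ~ clearable b N1'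
    & forall c, c \in B -> pb c *m N1' = 0 \/
        (pb c *m N1' = pb c *m N1 /\ (clearable c N1' -> clearable c N1))].
Proof.
move=> sB sbB red; elim: red sbB => {s N1 N2 N1' N2'}
  [N1 N2 _ pN1 pN2|b s N1 N2 N1' N2' N1'' N2'' br _ IH sbB pN1 pN2].
  split=> // [|c _]; last by right.
  by exists 1%:M, 0; split; [exact: aut1|exact: graded0| |]; rewrite mul1mx ?mulmx0 ?addr0.
have bB : b \in B by apply: sbB; rewrite mem_head.
have [[psi [U [apsi gU e1 e2]]] p1 p2 hb hc] := block_reduceP sB bB pN1 pN2 br.
have ssB : {subset s <= B} by move=> c cs; apply: sbB; rewrite inE cs orbT.
have [[phi [V [aphi gV f1 f2]]] q1 q2 hb' hc'] := IH ssB p1 p2.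
have [[_ [P gP eP]] _ _ _] := aphi.
split=> //.
- exists (phi *m psi), (P *m U + V); split; first exact: autM.
  + by apply: gradedD => //; apply: gradedM gU.
  + by rewrite f1 e1 !mulmxDr !mulmxA eP addrA.
  + by rewrite f2 e2 mulmxA.
- move=> c; rewrite inE => /orP[/eqP ->|]; last exact: hb'.
  case: (hc' b bB) => [|[e cl]]; first by left.
  by case: hb => [h|h]; [left; rewrite e | right => /cl].
move=> c cB; case: (hc' c cB) => [|[e cl]]; first by left.
case: (hc c cB) => [h|[e' cl']]; first by left; rewrite e.
by right; split=> [|/cl/cl' //]; rewrite e.
Qed.

Lemma uncleared_sub B l (N : 'M[K]_(m, l)) : uncleared B N \subset B.
Proof. by apply/subsetP => b; rewrite inE => /andP[]. Qed.

Lemma pB_uncleared B l (N : 'M[K]_(m, l)) : B \subset B0 -> pB B *m N = N ->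
  pB (uncleared B N) *m N = N.
Proof.
move=> sB pN; rewrite -[RHS]pN (pB_sum bd sB).
rewrite (pB_sum bd (subset_trans (uncleared_sub B N) sB)) !mulmx_suml.
rewrite [RHS](big_setID (uncleared B N)) /= (setIidPr (uncleared_sub B N)).
rewrite [X in _ = _ + X]big1 ?addr0 // => b; rewrite !inE => /andP[].
by case: (b \in B) => //=; rewrite negbK rsub_eq0 => /eqP.
Qed.

Lemma uncleared_ncl B s l1 l2 (N1 : 'M[K]_(m, l1)) (N2 : 'M[K]_(m, l2)) N1' N2' b :
  B \subset B0 -> perm_eq s (enum B) ->
  reduce_all G R alpha M B s N1 N2 N1' N2' ->
  pB B *m N1 = N1 -> pB B *m N2 = N2 ->
  b \in uncleared B N1' -> ~ clearable b N1'.
Proof.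
move=> sB ps red p1 p2; rewrite inE rsub_eq0 => /andP[bB nz].
have sE : s =i B by move=> c; rewrite (perm_mem ps) mem_enum.
have [|_ _ _ h _] := reduce_allP sB _ red p1 p2; first by move=> c; rewrite sE.
by have [||//] := h b; rewrite ?sE // => e; rewrite e eqxx in nz.
Qed.

Lemma jointP B1 B2 l1 l2 (N1 : 'M[K]_(m, l1)) (N2 : 'M[K]_(m, l2)) :
  B1 \subset B0 -> B2 \subset B0 -> pB B1 *m N1 = N1 ->
  joint_reduction G R alpha M B1 B2 N1 N2 ->
  exists delta U W, [/\ endo G R M delta, pB B1 *m delta = delta,
    delta *m pB B2 = delta, ra U
    & pB B1 *m N2 + delta *m N2 + M *m U + N1 *m W = 0].
Proof.
move=> sB1 sB2 pN1 [Q [P [U [W [gQ gP gU e1 e2]]]]].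
have c1 := cut_join bd sB1; have c2 := cut_join bd sB2.
exists (emb K (join B1).1 *m Q *m (emb K (join B2).1)^T), (emb K (join B1).2 *m U), W.
split.
- exact: endo_of_hom e1.
- by rewrite !mulmxA pr_emb.
- by rewrite -!mulmxA embT_pr.
- by apply: gradedM gU; apply: graded_emb.
have := congr1 (mulmx (emb K (join B1).1)) e2.
rewrite mulmx0 !mulmxDr -!embTE block_submxE !mulmxA embK pN1 c1.
by rewrite -(mulmxA M (pr K _)) pr_emb.
Qed.

(** An endomorphism [chi] into [B1] that is the identity on [B1] only up to
    [nul] is good enough, as [U] absorbs the difference. *)
Lemma joint_of_endo B1 B2 l1 l2 (N1 : 'M[K]_(m, l1)) (N2 : 'M[K]_(m, l2)) chi W :
  B1 \subset B0 -> B2 \subset B0 -> pB B1 *m N1 = N1 ->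
  (pB B1 + pB B2) *m N2 = N2 -> ga N2 ->
  endo G R M chi -> pB B1 *m chi = chi -> nul R M G (chi *m pB B1 - pB B1) ->
  nula (chi *m N2 + N1 *m W) ->
  joint_reduction G R alpha M B1 B2 N1 N2.
Proof.
move=> sB1 sB2 pN1 pN2 gN2 echi pchi nchi nN2.
have [_ [P gP eP]] := echi.
have c1 := cut_join bd sB1; have c2 := cut_join bd sB2.
have [U gU eU] : nula (pB B1 *m N2 + chi *m (pB B2 *m N2) + N1 *m W).
  have -> : pB B1 *m N2 + chi *m (pB B2 *m N2) + N1 *m W =
    chi *m N2 + N1 *m W - (chi *m pB B1 - pB B1) *m N2.
    have -> : chi *m N2 = chi *m (pB B1 *m N2) + chi *m (pB B2 *m N2).
      by rewrite -mulmxDr -mulmxDl pN2.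
    by rewrite mulmxBl -!mulmxA opprB [RHS]addrC !addrA subrK.
  by apply: nulB => //; apply: nul_mulr nchi gN2.
exists ((emb K (join B1).1)^T *m chi *m emb K (join B2).1).
exists (- ((emb K (join B1).2)^T *m P *m emb K (join B2).2)).
exists (- ((emb K (join B1).2)^T *m U)), W; split.
- exact: gradedM (gradedM (graded_embT _ G) echi.1) (graded_emb _ G).
- by apply: gradedN; exact: gradedM (gradedM (graded_embT _ R) gP) (graded_emb _ R).
- by apply: gradedN; apply: gradedM gU; apply: graded_embT.
- exact: hom_of_endo.
have := congr1 (mulmx (emb K (join B1).1)^T) eU.
rewrite !mulmxDr -!embTE mulmxN block_submxE => e.
have -> : (emb K (join B1).1)^T *m M *m emb K (join B1).2 *m ((emb K (join B1).2)^T *m U)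
    = (emb K (join B1).1)^T *m (M *m U).
  rewrite -!mulmxA (mulmxA (emb K (join B1).2)) embK (mulmxA M) -c1 !mulmxA embT_pr //.
rewrite -e addrAC -!mulmxA (mulmxA _ (pr K _)) embT_pr (mulmxA (emb K (join B2).1)) embK.
by rewrite subrr.
Qed.

End Reductions.

(** * An invariant splitting of the added columns is detected *)

Section Completeness.

Variables (K : finFieldType) (d m r : nat).
Variables (G : 'I_m -> deg d) (R : 'I_r -> deg d) (alpha : deg d).
Variables (M : 'M[K]_(m, r)) (B0 : {set block m r}).
Hypotheses (gM : graded G R M) (bd : block_decomposed B0 M).
Hypothesis ci : forall b, b \in B0 -> corner_indec G R M b.
Implicit Types (b c : block m r) (B : {set block m r}).
Local Notation pB B := (pr K (join B).1).
Local Notation nula := (nul R M (fun=> alpha)).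
Local Notation nulG := (nul R M G).
Local Notation clearable := (clearable G R alpha M).
Local Notation ga := (graded G (fun=> alpha)).
Local Notation ra := (graded R (fun=> alpha)).

Definition indep k (N : 'M[K]_(m, k)) := forall l (C : 'M[K]_(k, l)),
  nula (N *m C) -> C = 0.

(** The invariant of the recursion. The matrix [M] stays fixed; the rows of [N]
    outside the blocks in [B] are zero. *)
Definition admissible B k (N : 'M[K]_(m, k)) :=
  [/\ B \subset B0, ga N, pB B *m N = N, indep N
    & forall b, b \in B -> ~ clearable b N].

Lemma nula_MU k (U : 'M[K]_(r, k)) : ra U -> nula (M *m U).
Proof. by move=> gU; exists U. Qed.

(** Completeness: an idempotent [e] that maps the span of [N] to that of
    [N T1] forces the joint reduction to succeed after any choice of row
    operations that clear blocks of [N T1]. *)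
Lemma joint_of_idempotent B k (N : 'M[K]_(m, k)) e W l1 l2 (T1 : 'M[K]_(k, l1))
    (T2 : 'M[K]_(k, l2)) C s N1 N2 :
  admissible B N -> endo G R M e -> e *m e = e -> nula (e *m N - N *m W) ->
  W *m T1 = T1 -> W = T1 *m C ->
  perm_eq s (enum B) ->
  reduce_all G R alpha M B s (N *m T1) (N *m T2) N1 N2 ->
  joint_reduction G R alpha M (uncleared B N1) (B :\: uncleared B N1) N1 N2.
Proof.
move=> [sB gN pN _ ncl] ee idem eN WT1 WC ps red.
have gNT1 : ga (N *m T1) by apply: gradedMc.
have gNT2 : ga (N *m T2) by apply: gradedMc.
have pNT1 : pB B *m (N *m T1) = N *m T1 by rewrite mulmxA pN.
have pNT2 : pB B *m (N *m T2) = N *m T2 by rewrite mulmxA pN.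
have sE : s =i B by move=> c; rewrite (perm_mem ps) mem_enum.
have [|[psi [U [apsi gU e1 e2]]] pN1 pN2 _ _] := reduce_allP bd sB _ red pNT1 pNT2.
  by move=> c; rewrite sE.
have [epsi _ _ [psi' [epsi' f1 f2]]] := apsi.
set B1 := uncleared B N1; have sB1 : B1 \subset B by apply: uncleared_sub.
have sB10 := subset_trans sB1 sB.
have sB20 : B :\: B1 \subset B0 by apply: subset_trans sB; apply: subsetDl.
have ncl1 b : b \in B1 -> ~ clearable b N1.
  exact: (uncleared_ncl bd sB ps red pNT1 pNT2).
have p1N1 : pB B1 *m N1 = N1 by apply: (pB_uncleared bd).
have gN1 : ga N1.
  by rewrite e1; apply: gradedD; [apply: gradedM gNT1; apply: epsi.1 | apply: gradedM gU].
have gN2 : ga N2 by rewrite e2; apply: gradedM gNT2; apply: epsi.1.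
have ep1 : endo G R M (pB B1) := endo_pB G R bd sB10.
have [e' e'E] : exists e', e' = psi *m e *m psi' by eexists.
have ee' : endo G R M e' by rewrite e'E; apply: endoM => //; apply: endoM.
have ide' : e' *m e' = e'.
  by rewrite e'E -!mulmxA (mulmxA psi') f2 mul1mx (mulmxA e e) idem.
have e'psi : e' *m psi = psi *m e by rewrite e'E -!mulmxA f2 mulmx1.
have e'N1 : nula (e' *m N1 - N1).
  have -> : e' *m N1 - N1 = psi *m (e *m N - N *m W) *m T1 + (e' *m (M *m U) - M *m U).
    rewrite [in LHS]e1 mulmxDr mulmxA e'psi mulmxBr mulmxBl opprD addrACA.
    by rewrite -!mulmxA WT1.
  have nU := nula_MU gU.
  apply: nulD; first by apply: nul_mulc; apply: nul_endol epsi eN.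
  by apply: nulB => //; apply: nul_endol ee' nU.
have e'N2 : nula (e' *m N2 - N1 *m (C *m T2)).
  have -> : e' *m N2 - N1 *m (C *m T2) =
      psi *m (e *m N - N *m W) *m T2 - M *m U *m (C *m T2).
    rewrite [in LHS]e1 e2 mulmxA e'psi mulmxDl opprD addrA mulmxBr mulmxBl WC.
    by rewrite -!mulmxA.
  apply: nulB; first by apply: nul_mulc; apply: nul_endol epsi eN.
  by apply: nul_mulc; apply: nula_MU.
have [p1 p1E] : exists p, p = pB B1 by eexists.
rewrite -p1E in p1N1 ep1.
have p1K : p1 *m p1 = p1 by rewrite p1E prK.
(* As [u] fixes [N1], so does its idempotent power, and [p1 - u ^+ n] kills
   [N1]; by the exchange property [u ^+ n.-1] inverts [u] on the image of
   [p1]. *)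
have [u uE] : exists u, u = p1 *m e' *m p1 by eexists.
have eu : endo G R M u by rewrite uE; apply: endoM => //; apply: endoM.
have p1u : p1 *m u = u by rewrite uE !mulmxA p1K.
have up1 : u *m p1 = u by rewrite uE -!mulmxA p1K.
have uN1 : nula (u *m N1 - N1).
  have -> : u *m N1 - N1 = p1 *m (e' *m N1 - N1).
    by rewrite uE -mulmxA p1N1 mulmxBr p1N1 mulmxA.
  exact: nul_endol ep1 e'N1.
have [n n0 idu] := idempotent_power u.
have unN1 i : nula (u ^+ i *m N1 - N1).
  elim: i => [|i IHi]; first by rewrite expr0 mul1mx subrr; apply: nul0.
  rewrite exprS -mulmxE -mulmxA.
  have -> : u *m (u ^+ i *m N1) - N1 = u *m (u ^+ i *m N1 - N1) + (u *m N1 - N1).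
    by rewrite mulmxBr addrA subrK.
  by apply: nulD => //; apply: nul_endol eu IHi.
have p1un : p1 *m u ^+ n = u ^+ n.
  by case: n n0 {idu} => // n _; rewrite exprS -mulmxE mulmxA p1u.
have unp1 : u ^+ n *m p1 = u ^+ n.
  by case: n n0 {idu p1un} => // n _; rewrite exprSr -mulmxE -mulmxA up1.
have nun : nulG (p1 - u ^+ n).
  apply: (idempotent_annih_nul bd ci sB10 gN1 ncl1).
    rewrite /annih -p1E; split.
    - by apply: endoB => //; apply: endoX.
    - by rewrite mulmxBr p1K p1un.
    - by rewrite mulmxBl p1K unp1.
    by rewrite mulmxBl p1N1 -opprB; apply: nulN.
  by rewrite mulmxBr !mulmxBl p1K unp1 p1un idu subrr subr0.
pose theta := p1 *m u ^+ n.-1 *m p1 *m e'.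
have eun : endo G R M (p1 *m u ^+ n.-1 *m p1).
  by apply: endoM => //; apply: endoM => //; apply: endoX.
apply: (joint_of_endo bd sB10 sB20 _ (chi := theta) (W := - (C *m T2))) => //.
- by rewrite -p1E.
- by rewrite (pB_setD bd) // addrC subrK.
- exact: endoM.
- by rewrite -p1E /theta !mulmxA p1K.
- rewrite -p1E; have -> : theta *m p1 = u ^+ n.
    rewrite /theta -!mulmxA (mulmxA p1 e') -uE.
    have -> : u ^+ n.-1 *m u = u ^+ n by rewrite -[in RHS](prednK n0) exprSr.
    exact: p1un.
  by rewrite -opprB; apply: nulN.
have -> : theta *m N2 + N1 *m - (C *m T2) =
    p1 *m u ^+ n.-1 *m p1 *m (e' *m N2 - N1 *m (C *m T2)) +
    p1 *m (u ^+ n.-1 *m N1 - N1) *m (C *m T2).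
  rewrite /theta mulmxN !mulmxBr !mulmxBl -!mulmxA !(mulmxA p1 N1) p1N1.
  by rewrite subrKA.
apply: nulD; first exact: nul_endol eun e'N2.
by apply: nul_mulc; apply: nul_endol ep1 (unN1 _).
Qed.

End Completeness.

(** * A successful split passes the hypotheses on to both halves *)

Section Inheritance.

Variables (K : finFieldType) (d m r : nat).
Variables (G : 'I_m -> deg d) (R : 'I_r -> deg d) (alpha : deg d).
Variables (M : 'M[K]_(m, r)) (B0 : {set block m r}).
Hypotheses (gM : graded G R M) (bd : block_decomposed B0 M).
Hypothesis ci : forall b, b \in B0 -> corner_indec G R M b.
Hypothesis nz : forall b, b \in B0 -> ~ nul R M G (pr K b.1).
Implicit Types (b c : block m r) (B : {set block m r}).
Local Notation pb b := (pr K b.1).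
Local Notation pB B := (pr K (join B).1).
Local Notation nula := (nul R M (fun=> alpha)).
Local Notation nulG := (nul R M G).
Local Notation clearable := (clearable G R alpha M).
Local Notation aut := (aut G R M).
Local Notation ga := (graded G (fun=> alpha)).
Local Notation ra := (graded R (fun=> alpha)).
Local Notation indep := (indep R alpha M).
Local Notation admissible := (admissible G R alpha M B0).

(** The matrices [M N] and [M N'] present the same module, by an isomorphism
    that changes only the rows in [S]. *)
Definition eqv (S : {set 'I_m}) k (N : 'M[K]_(m, k)) k' (N' : 'M[K]_(m, k')) :=
  exists psi T T' U, [/\ aut S psi, T *m T' = 1%:M, T' *m T = 1%:M, ra U
    & N' = psi *m N *m T + M *m U].

Lemma eqv_trans (S S' : {set 'I_m}) k (N : 'M[K]_(m, k)) k' (N' : 'M[K]_(m, k'))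
    k'' (N'' : 'M[K]_(m, k'')) :
  S' \subset S -> eqv S N N' -> eqv S' N' N'' -> eqv S N N''.
Proof.
move=> sS [psi [T [T' [U [apsi e1 e2 gU eN]]]]].
move=> [phi [Y [Y' [V [aphi f1 f2 gV eN']]]]].
have [[_ [P gP eP]] _ _ _] := aphi.
exists (phi *m psi), (T *m Y), (Y' *m T'), (P *m U *m Y + V); split.
- by apply: autM => //; apply: autS aphi.
- by rewrite -mulmxA (mulmxA Y) f1 mul1mx.
- by rewrite -mulmxA (mulmxA T') e2 mul1mx.
- by apply: gradedD => //; apply: gradedMc; apply: gradedM gU.
by rewrite eN' eN !mulmxDr mulmxDl !mulmxA eP addrA.
Qed.

(** Each of the two automorphisms fixes the columns that the other one
    changes. *)
Lemma eqv_row_mx (S S1 S2 : {set 'I_m}) k1 (N1 : 'M[K]_(m, k1)) k2 (N2 : 'M[K]_(m, k2))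
    k1' (N1' : 'M[K]_(m, k1')) k2' (N2' : 'M[K]_(m, k2')) :
  S1 \subset S -> S2 \subset S -> pr K S1 *m pr K S2 = 0 ->
  pr K S1 *m N1 = N1 -> pr K S2 *m N2 = N2 ->
  eqv S1 N1 N1' -> eqv S2 N2 N2' -> eqv S (row_mx N1 N2) (row_mx N1' N2').
Proof.
move=> sS1 sS2 p12 pN1 pN2 [psi [T [T' [U [apsi e1 e2 gU eN]]]]].
move=> [phi [Y [Y' [V [aphi f1 f2 gV eN']]]]].
have p21 : pr K S2 *m pr K S1 = 0 by rewrite pr_mul setIC -pr_mul.
have h1 : psi *m phi *m N1 = psi *m N1.
  by rewrite -mulmxA (aut_id aphi) // -pN1 mulmxA p21 mul0mx.
have h2 : psi *m phi *m N2 = phi *m N2.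
  rewrite -mulmxA (aut_id apsi) // -pN2 (mulmxA phi) (aut_comm aphi) !mulmxA p12.
  by rewrite !mul0mx.
exists (psi *m phi), (block_mx T 0 0 Y), (block_mx T' 0 0 Y'), (row_mx U V); split.
- by apply: autM; [apply: autS apsi | apply: autS aphi].
- by rewrite mulmx_block e1 f1 !mulmx0 !mul0mx !addr0 add0r -scalar_mx_block.
- by rewrite mulmx_block e2 f2 !mulmx0 !mul0mx !addr0 add0r -scalar_mx_block.
- exact: graded_row_mxc.
rewrite !mul_mx_row h1 h2 mul_row_block !mulmx0 addr0 add0r add_row_mx.
by rewrite -eN -eN'.
Qed.

Lemma indep_eqv (S : {set 'I_m}) psi k (N : 'M[K]_(m, k)) l (T : 'M[K]_(k, l)) T'
    (U : 'M[K]_(r, l)) :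
  indep N -> aut S psi -> ra U -> T' *m T = 1%:M -> indep (psi *m N *m T + M *m U).
Proof.
move=> ind [_ _ _ [psi' [epsi' _ e2]]] gU TT l' C nC.
have h : nula (psi *m N *m (T *m C)).
  move: nC; rewrite mulmxDl -!mulmxA; apply: nul_addIr; rewrite mulmxA.
  by apply: nul_mulc; apply: nula_MU.
have : nula (N *m (T *m C)).
  by have := nul_endol epsi' h; rewrite -mulmxA (mulmxA psi') e2 mul1mx.
by move/ind => TC; rewrite -[C]mul1mx -TT -mulmxA TC mulmx0.
Qed.

Section Success.

Variables (B : {set block m r}) (k : nat) (N : 'M[K]_(m, k)).
Variables (l1 l2 : nat) (T1 : 'M[K]_(k, l1)) (T2 : 'M[K]_(k, l2)).
Variables (S1 : 'M[K]_(l1, k)) (S2 : 'M[K]_(l2, k)).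
Hypothesis adm : admissible B N.
Hypotheses (TS : T1 *m S1 + T2 *m S2 = 1%:M) (S1T1 : S1 *m T1 = 1%:M)
  (S1T2 : S1 *m T2 = 0) (S2T1 : S2 *m T1 = 0) (S2T2 : S2 *m T2 = 1%:M).
Variables (s : seq (block m r)) (N1 : 'M[K]_(m, l1)) (N2 : 'M[K]_(m, l2)).
Hypotheses (ps : perm_eq s (enum B))
  (red : reduce_all G R alpha M B s (N *m T1) (N *m T2) N1 N2).
Let B1 := uncleared B N1.
Let B2 := B :\: B1.
Let N2' := setrows (S := (join B1).1) 0 N2.
Hypothesis jr : joint_reduction G R alpha M B1 B2 N1 N2.

(** Only the absence of clearable blocks in the second half needs an idea. If
    [chi] clears [b] there, its restriction to the blocks of the second half
    kills [N1] as well, and its conjugate by the row operations is an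
    idempotent that kills [N]. It would have to vanish, although it restricts
    to the identity of [b]. *)
Lemma success_inheritance :
  [/\ admissible B1 N1, admissible B2 N2' & eqv (join B).1 N (row_mx N1 N2')].
Proof.
have [sB gN pN ind ncl] := adm.
have sE : s =i B by move=> c; rewrite (perm_mem ps) mem_enum.
have pNT1 : pB B *m (N *m T1) = N *m T1 by rewrite mulmxA pN.
have pNT2 : pB B *m (N *m T2) = N *m T2 by rewrite mulmxA pN.
have [|[psi [U [apsi gU e1 e2]]] pN1 pN2 _ _] := reduce_allP bd sB _ red pNT1 pNT2.
  by move=> c; rewrite sE.
have sB1 : B1 \subset B by apply: uncleared_sub.
have sB2 : B2 \subset B by apply: subsetDl.
have sB10 := subset_trans sB1 sB; have sB20 := subset_trans sB2 sB.
have dis : [disjoint B1 & B2].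
  by rewrite disjoint_sym disjoints_subset; apply/subsetP => b; rewrite !inE => /andP[].
have p12 : pB B1 *m pB B2 = 0 := pB_disjoint bd sB10 sB20 dis.
have p21 : pB B2 *m pB B1 = 0 by rewrite pr_mul setIC -pr_mul.
have pBB : pB B = pB B1 + pB B2 by rewrite (pB_setD bd) // addrC subrK.
have ncl1 b : b \in B1 -> ~ clearable b N1.
  exact: (uncleared_ncl bd sB ps red pNT1 pNT2).
have p1N1 : pB B1 *m N1 = N1 by apply: (pB_uncleared bd).
have [epsi _ _ _] := apsi.
have gN1 : ga N1.
  rewrite e1; apply: gradedD; last exact: gradedM gU.
  by apply: gradedM epsi.1 _; apply: gradedMc.
have gN2 : ga N2 by rewrite e2; apply: gradedM epsi.1 _; apply: gradedMc.
have gN2' : ga N2'.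
  rewrite /N2' setrowsE mulmx0 add0r; apply: gradedB => //.
  exact: gradedM (graded_pr _ _) gN2.
have eN2 : N2 = pB B1 *m N2 + pB B2 *m N2 by rewrite -mulmxDl -pBB pN2.
have eN2' : N2' = pB B2 *m N2.
  by rewrite /N2' setrowsE mulmx0 add0r {1}eN2 addrAC subrr add0r.
have p2N2' : pB B2 *m N2' = N2' by rewrite eN2' mulmxA prK.
have [delta [V [W [ed d1 d2 gV eJ]]]] := jointP bd sB10 sB20 p1N1 jr.
have sr1 : (join B1).1 \subset (join B).1.
  apply/subsetP => i /joinP1[b bB ib]; apply/joinP1.
  by exists b => //; apply: (subsetP sB1).
have sr2 : (join B2).1 \subset (join B).1.
  apply/subsetP => i /joinP1[b bB ib]; apply/joinP1.
  by exists b => //; apply: (subsetP sB2).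
have pp1 : pB B *m pB B1 = pB B1 by rewrite pr_mul (setIidPr sr1).
have pp2 : pB B2 *m pB B = pB B2 by rewrite pr_mul (setIidPl sr2).
have ashear : aut (join B).1 (1%:M + delta).
  apply: aut_shear => //.
  - by rewrite -d1 mulmxA pp1.
  - by rewrite -d2 -mulmxA pp2.
  by rewrite -[X in X *m _]d2 -[X in _ *m X]d1 -mulmxA (mulmxA (pB B2)) p21 mul0mx mulmx0.
(* All row operations made, those before and those of the joint reduction. *)
have [Psi PsiE] : exists x, x = (1%:M + delta) *m psi by eexists.
have aPsi : aut (join B).1 Psi by rewrite PsiE; apply: autM.
have dN1 : delta *m N1 = 0.
  by rewrite -d2 -p1N1 -mulmxA (mulmxA (pB B2)) p21 mul0mx mulmx0.
have [[gs [P gP eP]] _ _ _] := ashear.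
have f1 : N1 = Psi *m N *m T1 + M *m (P *m U).
  rewrite -[LHS](addr0) -dN1 -[X in X + _]mul1mx -mulmxDl [in LHS]e1 mulmxDr.
  by rewrite PsiE !mulmxA eP.
have f2 : N2' = Psi *m N *m (T2 + T1 *m W) + M *m (P *m U *m W + V).
  have -> : N2' = (1%:M + delta) *m N2 + N1 *m W + M *m V.
    rewrite eN2' mulmxDl mul1mx {2}eN2 [pB B1 *m N2 + _]addrC -!addrA.
    by move: eJ; rewrite -!addrA [N1 *m W + _]addrC => ->; rewrite addr0.
  by rewrite [in LHS]e2 [in LHS]f1 PsiE !mulmxDr !mulmxDl !mulmxA -!addrA.
have gPU : ra (P *m U) by apply: gradedM gU.
have gV' : ra (P *m U *m W + V) by apply: gradedD => //; apply: gradedMc.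
have ST2 : S2 *m (T2 + T1 *m W) = 1%:M by rewrite mulmxDr mulmxA S2T1 mul0mx addr0.
split.
- by split=> //; rewrite f1; apply: indep_eqv aPsi _ S1T1.
- split=> //; first by rewrite f2; apply: indep_eqv aPsi _ ST2.
  move=> b bB2 [chi [echi h1 h2 h3]]; have bB := subsetP sB2 b bB2.
  have bB0 := subsetP sB b bB.
  have [ePsi _ _ [Psi' [ePsi' g1 g2]]] := aPsi.
  have [chi' chi'E] : exists x, x = chi *m pB B2 by eexists.
  have echi' : endo G R M chi'.
    by rewrite chi'E; apply: endoM => //; exact: (endo_pB G R bd sB20).
  have c1 : pb b *m chi' = chi' by rewrite chi'E mulmxA h1.
  have c2 : chi' *m pb b = pb b by rewrite chi'E -mulmxA (pB_pb _ bB2).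
  have c3 : chi' *m chi' = chi' by rewrite -[X in _ *m X]c1 mulmxA c2 c1.
  have c4 : pB B *m chi' = chi' by rewrite -c1 mulmxA pB_pb.
  have c5 : chi' *m pB B = chi' by rewrite chi'E -mulmxA pp2.
  have com' : pB B *m Psi' = Psi' *m pB B.
    by rewrite -[LHS]mul1mx -g2 -!mulmxA (mulmxA Psi) (aut_comm aPsi) -!mulmxA g1 mulmx1.
  have nT1 : nula (chi' *m (Psi *m N *m T1)).
    apply: (@nul_addIr _ _ _ _ R M _ _ _ (chi' *m (M *m (P *m U)))).
      by apply: nul_endol echi' _; apply: nula_MU.
    by rewrite -mulmxDr -f1 chi'E -p1N1 -mulmxA (mulmxA (pB B2)) p21 mul0mx mulmx0; apply: nul0.
  have nT2 : nula (chi' *m (Psi *m N *m (T2 + T1 *m W))).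
    apply: (@nul_addIr _ _ _ _ R M _ _ _ (chi' *m (M *m (P *m U *m W + V)))).
      by apply: nul_endol echi' _; apply: nula_MU.
    by rewrite -mulmxDr -f2 chi'E -mulmxA p2N2'.
  have nN : nula (chi' *m (Psi *m N)).
    have -> : chi' *m (Psi *m N) = chi' *m (Psi *m N *m T1) *m (S1 - W *m S2) +
        chi' *m (Psi *m N *m (T2 + T1 *m W)) *m S2.
      rewrite -[LHS]mulmx1 -TS -!mulmxA -!mulmxDr; congr (_ *m (_ *m (_ *m _))).
      by rewrite mulmxBr mulmxDl -!mulmxA addrA addrAC subrK.
    by apply: nulD; apply: nul_mulc.
  have nh : nulG (Psi' *m chi' *m Psi).
    apply: (idempotent_annih_nul bd ci sB gN ncl).
      split.
      - by apply: endoM => //; apply: endoM.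
      - by rewrite !mulmxA com' -(mulmxA Psi') c4.
      - by rewrite -!mulmxA (aut_comm aPsi) !mulmxA -(mulmxA Psi') c5.
      by rewrite -!mulmxA; apply: nul_endol ePsi' _.
    by rewrite -!mulmxA (mulmxA Psi) g1 mul1mx (mulmxA chi') c3.
  apply: (nz bB0); rewrite -c2.
  apply: nul_mulr (graded_pr _ _).
  have -> : chi' = Psi *m (Psi' *m chi' *m Psi) *m Psi'.
    by rewrite !mulmxA g1 mul1mx -mulmxA g1 mulmx1.
  by apply: nul_mulr ePsi'.1; apply: nul_endol ePsi nh.
exists Psi, (row_mx T1 (T2 + T1 *m W)), (col_mx (S1 - W *m S2) S2).
exists (row_mx (P *m U) (P *m U *m W + V)); split=> //.
- by rewrite mul_row_col mulmxBr mulmxDl !mulmxA [T2 *m S2 + _]addrC subrKA.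
- have q1 : (S1 - W *m S2) *m T1 = 1%:M.
    by rewrite mulmxBl S1T1 -mulmxA S2T1 mulmx0 subr0.
  have q2 : (S1 - W *m S2) *m (T2 + T1 *m W) = 0.
    by rewrite mulmxBl -mulmxA ST2 mulmx1 mulmxDr S1T2 add0r mulmxA S1T1 mul1mx subrr.
  by rewrite mul_col_row q1 q2 S2T1 ST2 -scalar_mx_block.
- exact: graded_row_mxc.
by rewrite !mul_mx_row add_row_mx -f1 -f2.
Qed.

End Success.

End Inheritance.

(** * Block decompositions of some of the rows and columns *)

Section PartialDecompositions.

Variables (K : fieldType) (m : nat).

Lemma cutP n (A : 'M[K]_(m, n)) (b : block m n) :
  cut A b <-> forall i j, A i j != 0 -> (i \in b.1) = (j \in b.2).
Proof.
split=> [h i j nz|h].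
  have := congr1 (fun X : 'M_(m, n) => X i j) h; rewrite pr_mull pr_mulr.
  by case: ifP; case: ifP => // _ _ /eqP; rewrite ?[_ == A i j]eq_sym (negPf nz).
apply/matrixP => i j; rewrite pr_mull pr_mulr.
by case: (eqVneq (A i j) 0) => [->|/h ->//]; case: ifP; case: ifP.
Qed.

(** The shape of what a recursive call returns. The first clause separates the
    rows and columns it was given from all others, so that results combine. *)
Definition partial_decomp n (S : {set 'I_m}) (C : {set 'I_n}) (D : {set block m n})
    (A : 'M[K]_(m, n)) : Prop :=
  [/\ forall i j, A i j != 0 -> (i \in S) = (j \in C),
      forall b, b \in D -> b.1 \subset S /\ b.2 \subset C,
      (forall i, i \in S -> exists2 b, b \in D & i \in b.1) /\
      (forall j, j \in C -> exists2 b, b \in D & j \in b.2),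
      forall b c, b \in D -> c \in D ->
        (forall i, i \in b.1 -> i \in c.1 -> b = c) /\
        (forall j, j \in b.2 -> j \in c.2 -> b = c)
    & forall i j, i \in S -> A i j != 0 ->
        exists b, [/\ b \in D, i \in b.1 & j \in b.2]].

Lemma partial_decomp_cut n S C D (A : 'M[K]_(m, n)) b :
  partial_decomp S C D A -> b \in D -> cut A b.
Proof.
move=> [h1 h2 _ h4 h5] bD; have [sb1 sb2] := h2 b bD.
apply/cutP => i j nz; apply/idP/idP => [ib|jb].
  have [c [cD ic jc]] := h5 i j (subsetP sb1 i ib) nz.
  by rewrite ((h4 b c bD cD).1 i ib ic).
have iS : i \in S by rewrite (h1 i j nz) (subsetP sb2).
have [c [cD ic jc]] := h5 i j iS nz.
by rewrite ((h4 b c bD cD).2 j jb jc).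
Qed.

Lemma partial_decomp_setT n D (A : 'M[K]_(m, n)) :
  partial_decomp setT setT D A -> block_decomposed D A.
Proof.
move=> [_ _ [h3 h3'] h4 h5]; split=> [i|j|i j nz]; last exact: h5.
  have [b bD ib] := h3 i (in_setT i); exists b; split=> // c [cD ic].
  exact: (h4 b c bD cD).1 ib ic.
have [b bD jb] := h3' j (in_setT j); exists b; split=> // c [cD jc].
exact: (h4 b c bD cD).2 jb jc.
Qed.

Lemma partial_decompU n S1 C1 D1 S2 C2 D2 (A : 'M[K]_(m, n)) :
  partial_decomp S1 C1 D1 A -> partial_decomp S2 C2 D2 A ->
  [disjoint S1 & S2] -> [disjoint C1 & C2] ->
  partial_decomp (S1 :|: S2) (C1 :|: C2) (D1 :|: D2) A.
Proof.
move=> [a1 a2 [a3 a3'] a4 a5] [b1 b2 [b3 b3'] b4 b5] dS dC; split.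
- by move=> i j nz; rewrite !inE (a1 i j nz) (b1 i j nz).
- move=> b; rewrite inE => /orP[/a2|/b2] [s1 s2].
    by split; apply: subset_trans (subsetUl _ _).
  by split; apply: subset_trans (subsetUr _ _).
- split=> i; rewrite inE => /orP[].
  + by move/a3 => [b bD ib]; exists b; rewrite // inE bD.
  + by move/b3 => [b bD ib]; exists b; rewrite // inE bD orbT.
  + by move/a3' => [b bD ib]; exists b; rewrite // inE bD.
  + by move/b3' => [b bD ib]; exists b; rewrite // inE bD orbT.
- have cross b c : b \in D1 -> c \in D2 ->
      (forall i, i \in b.1 -> i \in c.1 -> b = c) /\
      (forall j, j \in b.2 -> j \in c.2 -> b = c).
    move=> /a2[s1 s2] /b2[t1 t2]; split=> i ib ic.
      by have := disjointFr dS (subsetP s1 i ib); rewrite (subsetP t1).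
    by have := disjointFr dC (subsetP s2 i ib); rewrite (subsetP t2).
  move=> b c; rewrite !inE => /orP[bD|bD] /orP[cD|cD].
  + exact: a4.
  + exact: cross.
  + by have [h h'] := cross c b cD bD; split=> i ib ic; [rewrite (h i) | rewrite (h' i)].
  + exact: b4.
- move=> i j; rewrite inE => /orP[iS nz|iS nz].
    by have [b [bD ib jb]] := a5 i j iS nz; exists b; rewrite inE bD.
  by have [b [bD ib jb]] := b5 i j iS nz; exists b; rewrite inE bD orbT.
Qed.

Lemma partial_decomp_recol n n1 (f : 'I_n1 -> 'I_n) (S : {set 'I_m})
    (C : {set 'I_n1}) D (A : 'M[K]_(m, n)) :
  injective f -> (forall i j, A i j != 0 -> (i \in S) = (j \in f @: C)) ->
  partial_decomp S C D (colsub f A) ->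
  partial_decomp S (f @: C) (recol f @: D) A.
Proof.
move=> injf cA [h1 h2 [h3 h3'] h4 h5]; split=> //.
- by move=> _ /imsetP[b bD ->]; have [s1 s2] := h2 b bD; split=> //=; apply: imsetS.
- split=> [i /h3[b bD ib]|_ /imsetP[j /h3'[b bD jb] ->]].
    by exists (recol f b) => //; apply: imset_f.
  by exists (recol f b); [apply: imset_f | rewrite /= imset_f].
- move=> _ _ /imsetP[b bD ->] /imsetP[c cD ->]; have [u1 u2] := h4 b c bD cD.
  split=> [i ib ic|_ /imsetP[j jb ->]]; first by rewrite (u1 i).
  by rewrite /= mem_imset // => jc; rewrite (u2 j).
move=> i j iS nz; have := cA i j nz; rewrite iS => /esym/imsetP[j' j'C ej].
have nz' : colsub f A i j' != 0 by rewrite mxE -ej.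
have [b [bD ib jb]] := h5 i j' iS nz'.
by exists (recol f b); split; rewrite ?imset_f //= ej imset_f.
Qed.

End PartialDecompositions.

(** Only the columns of the block enter its condition, so it survives the
    insertion of other columns. *)
Lemma corner_indec_recol (K : fieldType) d m n n1 (G : 'I_m -> deg d) (R : 'I_n -> deg d)
    (R1 : 'I_n1 -> deg d) (f : 'I_n1 -> 'I_n) (A : 'M[K]_(m, n)) b :
  injective f -> (forall j, R (f j) = R1 j) -> cut A (recol f b) ->
  corner_indec G R1 (colsub f A) b -> corner_indec G R A (recol f b).
Proof.
move=> injf Rf cA ci q [gq [P gP eP]] pq qp qq.
pose L : 'M[K]_(n, n1) := colsub f 1%:M.
have gL : graded R R1 L.
  by move=> i j hij; rewrite !mxE; case: eqP hij => // ->; rewrite Rf ledeg_refl.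
have gLT : graded R1 R L^T.
  by move=> i j hij; rewrite !mxE; case: eqP hij => // ->; rewrite Rf ledeg_refl.
have AL : colsub f A = A *m L.
  apply/matrixP => i j; rewrite !mxE (bigD1 (f j)) //= big1 => [|j' ne].
    by rewrite !mxE eqxx mulr1 addr0.
  by rewrite !mxE (negPf ne) mulr0.
have pL : pr K (f @: b.2) = L *m pr K b.2 *m L^T.
  apply/matrixP => i j; rewrite !mxE; case: (boolP (i \in f @: b.2)) => [/imsetP[i' ib ->]|ni].
    rewrite andbT (bigD1 i') //= big1 ?addr0 => [|j' ne].
      by rewrite pr_mulr ib !mxE eqxx mul1r eq_sym.
    by rewrite pr_mulr !mxE (inj_eq injf) eq_sym (negPf ne); case: ifP; rewrite mul0r.
  rewrite andbF big1 // => j' _; rewrite pr_mulr !mxE; case: ifP => jb; last by rewrite mul0r.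
  by case: eqP => [ei|_]; [rewrite ei imset_f in ni | rewrite mul0r].
have eq1 : endo G R1 (colsub f A) q.
  split=> //; exists (pr K b.2 *m L^T *m P *m L).
    apply: gradedM gL; apply: gradedM gP; apply: gradedM gLT.
    exact: (graded_pr b.2 R1).
  rewrite AL -pq -!mulmxA (mulmxA q) eP (mulmxA (pr K _)) (mulmxA (pr K _) A).
  by rewrite [pr K _ *m A]cA /= pL !mulmxA.
have nA X : nul R1 (colsub f A) G X -> nul R A G X.
  move=> [U gU ->]; rewrite AL -mulmxA; exists (L *m U) => //.
  exact: gradedM gU.
by case: (ci q eq1 pq qp qq) => /nA; [left | right].
Qed.

Section ColumnEmbeddings.

Variables (r k1 k2 : nat).

Lemma lcol_lshift j : lcol k2 (lshift k1 j) = lshift (k1 + k2) j :> 'I_(r + (k1 + k2)).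
Proof. by rewrite /lcol (unsplitK (inl j)). Qed.

Lemma lcol_rshift j : lcol k2 (rshift r j : 'I_(r + k1)) = rshift r (lshift k2 j).
Proof. by rewrite /lcol (unsplitK (inr j)). Qed.

Lemma rcol_lshift j : rcol k1 (lshift k2 j) = lshift (k1 + k2) j :> 'I_(r + (k1 + k2)).
Proof. by rewrite /rcol (unsplitK (inl j)). Qed.

Lemma rcol_rshift j : rcol k1 (rshift r j : 'I_(r + k2)) = rshift r (rshift k1 j).
Proof. by rewrite /rcol (unsplitK (inr j)). Qed.

Lemma lcol_inj : injective (@lcol r k1 k2).
Proof.
move=> i j; case: (split_ordP i) => i' ->; case: (split_ordP j) => j' ->;
  rewrite ?lcol_lshift ?lcol_rshift => /eqP;
  rewrite ?eq_lshift ?eq_rshift ?eq_lrshift ?eq_rlshift //.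
  by move/eqP ->.
by rewrite eq_lshift => /eqP ->.
Qed.

Lemma rcol_inj : injective (@rcol r k1 k2).
Proof.
move=> i j; case: (split_ordP i) => i' ->; case: (split_ordP j) => j' ->;
  rewrite ?rcol_lshift ?rcol_rshift => /eqP;
  rewrite ?eq_lshift ?eq_rshift ?eq_lrshift ?eq_rlshift //.
  by move/eqP ->.
by move/eqP ->.
Qed.

Lemma colsub_lcol (K : fieldType) m (M : 'M[K]_(m, r)) (N1 : 'M[K]_(m, k1))
    (N2 : 'M[K]_(m, k2)) :
  colsub (@lcol r k1 k2) (row_mx M (row_mx N1 N2)) = row_mx M N1.
Proof.
apply/matrixP => i j; rewrite mxE; case: (split_ordP j) => j' ->.
  by rewrite lcol_lshift !row_mxEl.
by rewrite lcol_rshift !row_mxEr row_mxEl.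
Qed.

Lemma colsub_rcol (K : fieldType) m (M : 'M[K]_(m, r)) (N1 : 'M[K]_(m, k1))
    (N2 : 'M[K]_(m, k2)) :
  colsub (@rcol r k1 k2) (row_mx M (row_mx N1 N2)) = row_mx M N2.
Proof.
apply/matrixP => i j; rewrite mxE; case: (split_ordP j) => j' ->.
  by rewrite rcol_lshift !row_mxEl.
by rewrite rcol_rshift !row_mxEr.
Qed.

Lemma addcols_lcol d (R : 'I_r -> deg d) alpha j :
  addcols R alpha (@lcol r k1 k2 j) = addcols R alpha j.
Proof.
rewrite /addcols; case: (split_ordP j) => j' ->.
  by rewrite lcol_lshift !(unsplitK (inl j')).
by rewrite lcol_rshift !(unsplitK (inr _)).
Qed.

Lemma addcols_rcol d (R : 'I_r -> deg d) alpha j :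
  addcols R alpha (@rcol r k1 k2 j) = addcols R alpha j.
Proof.
rewrite /addcols; case: (split_ordP j) => j' ->.
  by rewrite rcol_lshift !(unsplitK (inl j')).
by rewrite rcol_rshift !(unsplitK (inr _)).
Qed.

End ColumnEmbeddings.

Definition cols m r (B : {set block m r}) k : {set 'I_(r + k)} :=
  lshift k @: (join B).2 :|: @rshift r k @: [set: 'I_k].

Lemma mem_cols_lshift m r (B : {set block m r}) k j :
  (lshift k j \in cols B k) = (j \in (join B).2).
Proof.
rewrite inE mem_imset; last exact: lshift_inj.
case: imsetP => [[j' _ /eqP]|_]; rewrite ?orbF //.
by rewrite eq_lrshift.
Qed.

Lemma mem_cols_rshift m r (B : {set block m r}) k j :
  rshift r j \in cols B k.
Proof. by rewrite inE imset_f ?orbT ?inE. Qed.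

Lemma cols_glue m r (B1 B2 : {set block m r}) k1 k2 :
  @lcol r k1 k2 @: cols B1 k1 :|: @rcol r k1 k2 @: cols B2 k2 =
  cols (B1 :|: B2) (k1 + k2).
Proof.
have injl := @lcol_inj r k1 k2; have injr := @rcol_inj r k1 k2.
apply/setP => j; rewrite in_setU; case: (split_ordP j) => j' ->.
  rewrite mem_cols_lshift -{1}(lcol_lshift _ k2) -(rcol_lshift k1 k2).
  rewrite !mem_imset // !mem_cols_lshift.
  apply/orP/joinP2 => [[/joinP2[b bB jb]|/joinP2[b bB jb]]|[b]].
  - by exists b; rewrite // inE bB.
  - by exists b; rewrite // inE bB orbT.
  by rewrite inE => /orP[bB|bB] jb; [left|right]; apply/joinP2; exists b.
rewrite mem_cols_rshift; case: (split_ordP j') => s ->.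
  by rewrite -[rshift r _]lcol_rshift imset_f ?mem_cols_rshift.
by rewrite -[rshift r _]rcol_rshift orbC imset_f ?mem_cols_rshift.
Qed.

Lemma cols_disjoint m r (B1 B2 : {set block m r}) k1 k2 :
  [disjoint (join B1).2 & (join B2).2] ->
  [disjoint @lcol r k1 k2 @: cols B1 k1 & @rcol r k1 k2 @: cols B2 k2].
Proof.
move=> dis; rewrite -setI_eq0 -subset0; apply/subsetP => j; rewrite !inE.
case/andP => /imsetP[x xC ->] /imsetP[y yC] /eqP; move: xC yC.
case: (split_ordP x) => x' ->; case: (split_ordP y) => y' -> xC yC;
  rewrite ?lcol_lshift ?rcol_lshift ?lcol_rshift ?rcol_rshift
          ?eq_lshift ?eq_rshift ?eq_lrshift ?eq_rlshift //.
move/eqP => exy; rewrite exy !mem_cols_lshift in xC yC.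
by rewrite (disjointFr dis xC) in yC.
Qed.

(** * Outputs of the recursion *)

Section Exhaustive.

Variables (K : finFieldType) (d m r : nat).
Variables (G : 'I_m -> deg d) (R : 'I_r -> deg d) (alpha : deg d).
Variables (M : 'M[K]_(m, r)) (B0 : {set block m r}).
Variable dec : forall k, seq (splitmx K k).
Hypotheses (gM : graded G R M) (bd : block_decomposed B0 M).
Hypothesis ci : forall b, b \in B0 -> corner_indec G R M b.
Hypothesis nz : forall b, b \in B0 -> ~ nul R M G (pr K b.1).
Hypothesis ngeR : forall j, ~~ ledeg alpha (R j).
Hypothesis hdec : forall k, is_dec (dec k).
Implicit Types (b c : block m r) (B : {set block m r}).
Local Notation pB B := (pr K (join B).1).
Local Notation nula := (nul R M (fun=> alpha)).
Local Notation nulG := (nul R M G).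
Local Notation admissible := (admissible G R alpha M B0).
Local Notation eqv := (eqv G R alpha M).
Local Notation Ra k := (@addcols d r R k alpha).

(** As a run may choose among solutions, failure of [t] means that some run of
    the reductions ended without a joint reduction. *)
Definition fails B k (N : 'M[K]_(m, k)) (t : splitmx K k) := exists s N1 N2,
  [/\ perm_eq s (enum B),
      reduce_all G R alpha M B s (N *m sp1 t) (N *m sp2 t) N1 N2
    & ~ joint_reduction G R alpha M (uncleared B N1) (B :\: uncleared B N1) N1 N2].

(** If all elements of Dec fail, every idempotent that preserves the span of
    [N] is trivial: otherwise [W] or [1 - W] has its image in the list. *)
Lemma idempotent_of_fails B k (N : 'M[K]_(m, k)) q W :
  admissible B N -> (forall t, t \in dec k -> fails B N t) ->
  endo G R M q -> pB B *m q = q -> q *m pB B = q -> q *m q = q ->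
  nula (q *m N - N *m W) -> nulG q \/ nulG (pB B - q).
Proof.
move=> adm hf eq pq qp qq nW; have [sB gN pN ind ncl] := adm.
have ep : endo G R M (pB B) := endo_pB G R bd sB.
have eq' : endo G R M (pB B - q) by apply: endoB.
have qq' : (pB B - q) *m (pB B - q) = pB B - q.
  by rewrite mulmxBr !mulmxBl prK qp pq qq subrr subr0.
have nW' : nula ((pB B - q) *m N - N *m (1%:M - W)).
  have -> : (pB B - q) *m N - N *m (1%:M - W) = - (q *m N - N *m W).
    by rewrite mulmxBl pN mulmxBr mulmx1 !opprB addrC addrA subrK.
  exact: nulN.
have WW : W *m W = W.
  apply/eqP; rewrite -subr_eq0; apply/eqP; apply: ind.
  have -> : N *m (W *m W - W) = (q *m N - N *m W) - q *m (q *m N - N *m W)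
      - (q *m N - N *m W) *m W.
    rewrite mulmxBr mulmxBl mulmxBr !mulmxA qq !opprB.
    by rewrite [q *m N - N *m W + _]addrC subrKA [RHS]addrC subrKA.
  apply: nulB; last exact: nul_mulc.
  by apply: nulB => //; apply: nul_endol eq nW.
case: (classic (nulG q)) => [|nq]; first by left.
case: (classic (nulG (pB B - q))) => [|nq']; first by right.
have kill phi : endo G R M phi -> pB B *m phi = phi -> phi *m pB B = phi ->
    phi *m phi = phi -> nula (phi *m N) -> nulG phi.
  by move=> e1 e2 e3 e4 e5; apply: (idempotent_annih_nul bd ci sB gN ncl).
have W0 : W != 0.
  apply/eqP => W0; apply: nq; apply: kill => //.
  by move: nW; rewrite W0 mulmx0 subr0.
have W1 : W != 1%:M.
  apply/eqP => W1; apply: nq'; apply: kill => //.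
  - by rewrite mulmxBr prK pq.
  - by rewrite mulmxBl prK qp.
  by move: nW'; rewrite W1 subrr mulmx0 subr0.
have [t td [C hC]] := dec_choice (hdec k) WW W0 W1.
have [s [N1 [N2 [ps red nj]]]] := hf t td.
case: nj; case: hC => -[eC eT].
  exact: (joint_of_idempotent gM bd ci adm eq qq nW eT eC ps red).
exact: (joint_of_idempotent gM bd ci adm eq' qq' nW' eT eC ps red).
Qed.

Lemma cut_cols B k (N : 'M[K]_(m, k)) : B \subset B0 -> pB B *m N = N ->
  forall i j, row_mx M N i j != 0 -> (i \in (join B).1) = (j \in cols B k).
Proof.
move=> sB pN i j; case: (split_ordP j) => j' ->.
  rewrite row_mxEl mem_cols_lshift; have /cutP := cut_join bd sB; exact.
rewrite row_mxEr mem_cols_rshift -pN pr_mull; case: ifP => //.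
by rewrite eqxx.
Qed.

(** Idempotents of [M N] preserve the span of [N] and restrict to [M], since a
    combination of columns of degree [alpha] cannot enter a column of [M]. *)
Lemma single_corner B k (N : 'M[K]_(m, k)) :
  admissible B N -> (forall t, t \in dec k -> fails B N t) ->
  corner_indec G (Ra k) (row_mx M N) ((join B).1, cols B k).
Proof.
move=> adm hf q [gq [P gP eP]] /= pq qp qq.
have : nul (Ra k) (row_mx M N) (catdeg R (fun=> alpha)) (q *m row_mx M N).
  by exists P.
rewrite mul_mx_row => /nul_row_mx[/nul_of_row_mx[U [V [gU gV eqM]]]].
move=> /nul_of_row_mx[U' [W [gU' gW eqN]]].
(* No column of [M] has degree at least [alpha]. *)
have V0 : V = 0 by apply/matrixP => i j; rewrite mxE gV // ngeR.
have eq : endo G R M q by split=> //; exists U => //; rewrite eqM V0 mulmx0 addr0.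
have nW : nula (q *m N - N *m W) by rewrite eqN addrK; exists U'.
have lift X : nulG X -> nul (Ra k) (row_mx M N) G X.
  move=> [Y gY ->]; apply/nul_of_row_mx; exists Y, 0; split=> //; first exact: graded0.
  by rewrite mulmx0 addr0.
by case: (idempotent_of_fails adm hf eq pq qp qq nW) => /lift; [left | right].
Qed.

Definition decomposes B k (N : 'M[K]_(m, k)) (res : result K m r) :=
  [/\ eqv (join B).1 N (rN res), pB B *m rN res = rN res,
      partial_decomp (join B).1 (cols B (rk res)) (rB res) (row_mx M (rN res))
    & forall x, x \in rB res -> x.1 != set0 /\
        corner_indec G (Ra (rk res)) (row_mx M (rN res)) x].

Lemma eqv_refl S k (N : 'M[K]_(m, k)) : eqv S N N.
Proof.
exists 1%:M, 1%:M, 1%:M, 0; split; rewrite ?mulmx1 ?mul1mx ?mulmx0 ?addr0 //.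
  exact: aut1.
exact: graded0.
Qed.

Lemma single_decomposes B k (N : 'M[K]_(m, k)) : admissible B N -> (0 < k)%N ->
  (forall t, t \in dec k -> fails B N t) -> decomposes B N (single B N).
Proof.
move=> adm k0 hf; have [sB gN pN ind ncl] := adm.
split=> //=; first exact: eqv_refl.
  split.
  - exact: cut_cols.
  - by move=> b /set1P ->; rewrite /= !subxx.
  - by split=> i iS; exists ((join B).1, cols B k); rewrite ?set11.
  - by move=> b c /set1P -> /set1P ->.
  move=> i j iS nzij; exists ((join B).1, cols B k); split; rewrite ?set11 //=.
  by rewrite -(cut_cols sB pN nzij).
move=> b /set1P ->; split; last exact: single_corner.
apply/eqP => S0; have N0 : N = 0 by rewrite -pN (S0 : (join B).1 = set0) pr0 mul0mx.
have : (1%:M : 'M[K]_k) = 0 by apply: ind; rewrite N0 mul0mx; apply: nul0.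
by move/matrixP/(_ (Ordinal k0) (Ordinal k0))/eqP; rewrite !mxE eqxx oner_eq0.
Qed.

Lemma join_rowU B1 B2 : (join (B1 :|: B2)).1 = (join B1).1 :|: (join B2).1.
Proof. by rewrite /join /= bigcup_setU. Qed.

Lemma lcol_rows B k1 k2 (N1 : 'M[K]_(m, k1)) (N2 : 'M[K]_(m, k2)) :
  B \subset B0 -> pB B *m N1 = N1 -> pB B *m N2 = 0 ->
  forall i j, row_mx M (row_mx N1 N2) i j != 0 ->
    (i \in (join B).1) = (j \in @lcol r k1 k2 @: cols B k1).
Proof.
move=> sB pN1 pN2 i j; have hi := @lcol_inj r k1 k2.
case: (split_ordP j) => j' -> {j}.
  rewrite row_mxEl -(lcol_lshift _ k2) mem_imset // mem_cols_lshift.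
  have /cutP := cut_join bd sB; exact.
rewrite row_mxEr; case: (split_ordP j') => s -> {j'}.
  rewrite row_mxEl -[rshift r _]lcol_rshift mem_imset // mem_cols_rshift.
  by rewrite -pN1 pr_mull; case: ifP => //; rewrite eqxx.
rewrite row_mxEr => nzi; apply/idP/idP => [i1|/imsetP[x _]].
  have := congr1 (fun X : 'M_(m, k2) => X i s) pN2.
  by rewrite pr_mull i1 mxE => z; rewrite z eqxx in nzi.
case: (split_ordP x) => x' -> /eqP; rewrite ?lcol_lshift ?lcol_rshift.
  by rewrite eq_rlshift.
by rewrite eq_rshift eq_rlshift.
Qed.

Lemma rcol_rows B k1 k2 (N1 : 'M[K]_(m, k1)) (N2 : 'M[K]_(m, k2)) :
  B \subset B0 -> pB B *m N2 = N2 -> pB B *m N1 = 0 ->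
  forall i j, row_mx M (row_mx N1 N2) i j != 0 ->
    (i \in (join B).1) = (j \in @rcol r k1 k2 @: cols B k2).
Proof.
move=> sB pN2 pN1 i j; have hi := @rcol_inj r k1 k2.
case: (split_ordP j) => j' -> {j}.
  rewrite row_mxEl -(rcol_lshift k1) mem_imset // mem_cols_lshift.
  have /cutP := cut_join bd sB; exact.
rewrite row_mxEr; case: (split_ordP j') => s -> {j'}; last first.
  rewrite row_mxEr -[rshift r _]rcol_rshift mem_imset // mem_cols_rshift.
  by rewrite -pN2 pr_mull; case: ifP => //; rewrite eqxx.
rewrite row_mxEl => nzi; apply/idP/idP => [i1|/imsetP[x _]].
  have := congr1 (fun X : 'M_(m, k1) => X i s) pN1.
  by rewrite pr_mull i1 mxE => z; rewrite z eqxx in nzi.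
case: (split_ordP x) => x' -> /eqP; rewrite ?rcol_lshift ?rcol_rshift.
  by rewrite eq_rlshift.
by rewrite eq_rshift eq_lrshift.
Qed.

Lemma join_disjoint B1 B2 : B1 \subset B0 -> B2 \subset B0 -> [disjoint B1 & B2] ->
  [disjoint (join B1).1 & (join B2).1] /\ [disjoint (join B1).2 & (join B2).2].
Proof.
move=> sB1 sB2 dis; split; rewrite -setI_eq0 -subset0; apply/subsetP => i;
  rewrite !inE => /andP[].
  move=> /joinP1[b bB ib]; rewrite (join_row bd sB2 (subsetP sB1 b bB) ib).
  by rewrite (disjointFr dis bB).
move=> /joinP2[b bB ib]; rewrite (join_col bd sB2 (subsetP sB1 b bB) ib).
by rewrite (disjointFr dis bB).
Qed.

Lemma glue_decomposes B k (N : 'M[K]_(m, k)) B1 B2 k1 k2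
    (N1 : 'M[K]_(m, k1)) (N2 : 'M[K]_(m, k2)) res1 res2 :
  B = B1 :|: B2 -> [disjoint B1 & B2] ->
  admissible B1 N1 -> admissible B2 N2 -> eqv (join B).1 N (row_mx N1 N2) ->
  decomposes B1 N1 res1 -> decomposes B2 N2 res2 -> decomposes B N (glue res1 res2).
Proof.
move=> BE dis [sB1 gN1 pN1 _ _] [sB2 gN2 pN2 _ _] eN [e1 q1 d1 c1] [e2 q2 d2 c2].
have sr1 : (join B1).1 \subset (join B).1 by rewrite BE join_rowU subsetUl.
have sr2 : (join B2).1 \subset (join B).1 by rewrite BE join_rowU subsetUr.
have sB : B \subset B0 by rewrite BE subUset sB1.
have pr1 : pB B *m rN res1 = rN res1 by rewrite -q1 mulmxA pr_mul (setIidPr sr1).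
have pr2 : pB B *m rN res2 = rN res2 by rewrite -q2 mulmxA pr_mul (setIidPr sr2).
have p12 : pB B1 *m pB B2 = 0 := pB_disjoint bd sB1 sB2 dis.
have p21 : pB B2 *m pB B1 = 0 by rewrite pr_mul setIC -pr_mul.
have z12 : pB B1 *m rN res2 = 0 by rewrite -q2 mulmxA p12 mul0mx.
have z21 : pB B2 *m rN res1 = 0 by rewrite -q1 mulmxA p21 mul0mx.
have [disr disc] := join_disjoint sB1 sB2 dis.
set A := row_mx M (row_mx (rN res1) (rN res2)).
have D1 : partial_decomp (join B1).1 (@lcol r (rk res1) (rk res2) @: cols B1 (rk res1))
    (recol (@lcol r (rk res1) (rk res2)) @: rB res1) A.
  apply: partial_decomp_recol; [exact: lcol_inj|exact: lcol_rows|].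
  by rewrite colsub_lcol.
have D2 : partial_decomp (join B2).1 (@rcol r (rk res1) (rk res2) @: cols B2 (rk res2))
    (recol (@rcol r (rk res1) (rk res2)) @: rB res2) A.
  apply: partial_decomp_recol; [exact: rcol_inj|exact: rcol_rows|].
  by rewrite colsub_rcol.
have D12 := partial_decompU D1 D2 disr (cols_disjoint _ _ disc).
rewrite -join_rowU cols_glue -BE in D12.
split=> /=.
- by apply: eqv_trans eN _ => //; apply: eqv_row_mx e1 e2.
- by rewrite mul_mx_row pr1 pr2.
- exact: D12.
move=> x /setUP[] bD.
  have cb := partial_decomp_cut D1 bD; case/imsetP: bD cb => c cD -> cb.
  have [c0 cc] := c1 c cD; split=> //.
  apply: (corner_indec_recol _ (addcols_lcol _ _ _)) => //; first exact: lcol_inj.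
  by rewrite colsub_lcol.
have cb := partial_decomp_cut D2 bD; case/imsetP: bD cb => c cD -> cb.
have [c0 cc] := c2 c cD; split=> //.
apply: (corner_indec_recol _ (addcols_rcol _ _ _)) => //; first exact: rcol_inj.
by rewrite colsub_rcol.
Qed.

End Exhaustive.

(** * Induction over the run, termination, and consequences of minimality *)

Scheme exhaustive_mut := Minimality for exhaustive Sort Prop
with attempts_mut := Minimality for attempts Sort Prop.

Section Correctness.

Variables (K : finFieldType) (d m r : nat).
Variables (G : 'I_m -> deg d) (R : 'I_r -> deg d) (alpha : deg d).
Variables (M : 'M[K]_(m, r)) (B0 : {set block m r}).
Variable dec : forall k, seq (splitmx K k).
Hypothesis hdec : forall k, is_dec (dec k).
Implicit Types (b c : block m r) (B : {set block m r}).

Section Induction.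

Hypotheses (gM : graded G R M) (bd : block_decomposed B0 M).
Hypothesis ci : forall b, b \in B0 -> corner_indec G R M b.
Hypothesis nz : forall b, b \in B0 -> ~ nul R M G (pr K b.1).
Hypothesis ngeR : forall j, ~~ ledeg alpha (R j).
Local Notation admissible := (admissible G R alpha M B0).
Local Notation decomposes := (decomposes G R alpha M).
Local Notation fails := (fails G R alpha M).

Lemma exhaustive_decomposes k B (N : 'M[K]_(m, k)) res :
  exhaustive G R alpha M dec B N res -> admissible B N -> (0 < k)%N ->
  decomposes B N res.
Proof.
apply: (@exhaustive_mut K d m r G R alpha M dec
  (fun k B N res => admissible B N -> (0 < k)%N -> decomposes B N res)
  (fun k ts B N res => admissible B N -> (0 < k)%N -> {subset ts <= dec k} ->
    (forall t, t \in dec k -> t \notin ts -> fails B N t) -> decomposes B N res))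
  => {k B N res}.
- move=> k B N res _ IH adm k0; apply: IH => // t td; by rewrite td.
- move=> k B N adm k0 _ hf; apply: (single_decomposes gM bd ci ngeR hdec) => // t td.
  exact: hf.
- move=> k t ts B N s N1 N2 res1 res2 ps red B1 B2 jr _ IH1 _ IH2 adm k0 sts _.
  have td : t \in dec k by apply: sts; rewrite mem_head.
  have [l0 lk [S1 [S2 [e1 e2 e3 e4 e5]]]] := dec_invertible (hdec k) td.
  have [a1 a2 eN] := success_inheritance gM bd ci nz adm e1 e2 e3 e4 e5 ps red jr.
  have sB1 : B1 \subset B by apply: uncleared_sub.
  apply: (glue_decomposes bd (B1 := B1) (B2 := B2) _ _ a1 a2 eN (IH1 a1 l0)).
  + by rewrite /B2 -{1}(setID B B1) (setIidPr sB1).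
  + by rewrite disjoint_sym disjoints_subset; apply/subsetP => b; rewrite !inE => /andP[].
  apply: IH2 => //; lia.
move=> k t ts B N s N1 N2 res ps red B1 B2 nj _ IH adm k0 sts hf.
apply: IH => // [u us|u ud nu]; first by apply: sts; rewrite inE us orbT.
have [->|ut] := eqVneq u t; first by exists s, N1, N2.
by apply: hf => //; rewrite inE negb_or ut.
Qed.

End Induction.

Section Existence.

Lemma reduce_all_exists B s l1 l2 (N1 : 'M[K]_(m, l1)) (N2 : 'M[K]_(m, l2)) :
  exists N1' N2', reduce_all G R alpha M B s N1 N2 N1' N2'.
Proof.
elim: s N1 N2 => [|b s IHs] N1 N2; first by exists N1, N2; apply: RA_nil.
have [N1' [N2' br]] : exists N1' N2', block_reduce G R alpha M B b N1 N2 N1' N2'.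
  case: (classic (exists Q P U, @reduction _ _ _ _ G R alpha M B b l1 N1 Q P U)).
    by move=> [Q [P [U h]]]; do 2 eexists; apply: BR_clear h.
  move=> n; exists N1, N2; apply: BR_keep => Q P U h; apply: n.
  by exists Q, P, U.
have [N1'' [N2'' ra]] := IHs N1' N2'; exists N1'', N2''.
exact: RA_cons br ra.
Qed.

Lemma exhaustive_exists k B (N : 'M[K]_(m, k)) :
  exists res, exhaustive G R alpha M dec B N res.
Proof.
elim: {k}(k.+1) {-2}k (ltnSn k) B N => // n IH k kn B N.
suff h (ts : seq (splitmx K k)) : {subset ts <= dec k} ->
    exists res, attempts G R alpha M dec ts B N res.
  by have [//|res h'] := h (dec k); exists res; apply: Exhaustive.
elim: ts => [_|t ts IHt sts]; first by eexists; apply: AT_none.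
have td : t \in dec k by apply: sts; rewrite mem_head.
have [l0 lk _] := dec_invertible (hdec k) td.
have [N1 [N2 red]] := reduce_all_exists B (enum B) (N *m sp1 t) (N *m sp2 t).
case: (classic (joint_reduction G R alpha M (uncleared B N1)
    (B :\: uncleared B N1) N1 N2)) => jr.
  have [|res1 h1] := IH (tag t) _ (uncleared B N1) N1; first by lia.
  have [|res2 h2] := IH (k - tag t)%N _ (B :\: uncleared B N1)
    (setrows (S := (join (uncleared B N1)).1) 0 N2); first by lia.
  by exists (glue res1 res2); apply: AT_success red jr h1 h2.
have [|res h] := IHt; first by move=> u us; apply: sts; rewrite inE us orbT.
by exists res; apply: AT_failure red jr h.
Qed.

End Existence.

End Correctness.

Section Minimality.

Variables (K : fieldType) (d m r : nat) (G : 'I_m -> deg d) (R : 'I_r -> deg d).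
Variable M : 'M[K]_(m, r).

(** A block that presents the zero module could be deleted together with its
    rows. *)
Lemma minimal_block_nonzero r' (R' : 'I_r' -> deg d) (A : 'M[K]_(m, r')) b :
  minimal G R M -> graded G R' A -> gmiso (coker G R' A) (coker G R M) ->
  cut A b -> b.1 != set0 -> ~ nul R' A G (pr K b.1).
Proof.
move=> min gA iso cb b0 nb; pose c : block m r' := (~: b.1, ~: b.2).
have cc : cut A c.
  by apply/cutP => i j nzij; have /cutP h := cb; rewrite !inE (h i j nzij).
have gS : graded (degs c.1 G) (degs c.2 R') (submx c A).
  by move=> i j hij; rewrite mxE gA.
have i1 : gmiso (coker (degs c.1 G) (degs c.2 R') (submx c A)) (coker G R' A).
  apply: (coker_iso (F := emb K c.1) (F' := (emb K c.1)^T)).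
  - exact: graded_emb.
  - exists (emb K c.2); first exact: graded_emb.
    by rewrite block_submxE !mulmxA embK cc -!mulmxA pr_emb.
  - exact: graded_embT.
  - exists (emb K c.2)^T; first exact: graded_embT.
    by rewrite block_submxE -!mulmxA embK -cc mulmxA embT_pr.
  - by rewrite embTK subrr; apply: nul0.
  by rewrite embK prC addrAC subrr add0r; apply: nulN.
have [lem _] := min _ _ _ _ _ gS (gmiso_trans i1 iso).
have := cardsC b.1; rewrite cardE -cardE card_ord.
by move: b0 lem; rewrite -card_gt0 /=; lia.
Qed.

(** A linear relation between the added columns would make one of them
    redundant. *)
Lemma minimal_indep k alpha (N : 'M[K]_(m, k)) :
  graded G R M -> graded G (fun=> alpha) N ->
  minimal G (addcols R alpha) (row_mx M N) ->
  forall v : 'cV[K]_k, nul R M (fun=> alpha) (N *m v) -> v = 0.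
Proof.
move=> gM gN min v [U gU eU]; apply/colP => j0; rewrite [RHS]mxE.
apply/eqP; apply: contraT => vj0.
(* [1 - v w] is the projection along [v] that annihilates the entry [j0]. *)
pose w : 'rV[K]_k := (v j0 0)^-1 *: delta_mx 0 j0.
pose D := emb K [set~ j0].
have DD : D *m (D^T *m (1%:M - v *m w)) = 1%:M - v *m w.
  rewrite mulmxA embK; apply/matrixP => i j; rewrite pr_mull !inE.
  case: eqP => //= ->; rewrite !mxE big_ord1 !mxE eqxx /=.
  by rewrite [j0 == j]eq_sym mulrA divff // mul1r subrr.
have eN : N = (N *m D) *m (D^T *m (1%:M - v *m w)) + M *m (U *m w).
  by rewrite -mulmxA DD mulmxBr mulmx1 !mulmxA eU subrK.
have gND : graded G (fun=> alpha) (N *m D) by apply: gradedMc.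
have gA : graded G (addcols R alpha) (row_mx M (N *m D)) by apply/graded_row_mx.
have nM (l : nat) (X : 'M[K]_(m, l)) : nul (addcols R alpha) (row_mx M X) R M.
  apply/nul_of_row_mx; exists 1%:M, 0; split; [exact: graded1|exact: graded0|].
  by rewrite mulmx1 mulmx0 addr0.
have gc l (X : 'M[K]_(k, l)) : graded (fun=> alpha) (fun=> alpha) X.
  by move=> i j; rewrite ledeg_refl.
have gc' l (X : 'M[K]_(_, l)) : graded (fun _ : 'I_#|[set~ j0]| => alpha) (fun=> alpha) X.
  by move=> i j; rewrite ledeg_refl.
have i1 : gmiso (coker G (addcols R alpha) (row_mx M (N *m D)))
    (coker G (addcols R alpha) (row_mx M N)).
  apply: (coker_iso (F := 1%:M) (F' := 1%:M)); rewrite ?mul1mx; first exact: graded1.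
  - apply/nul_row_mx; split; first exact: nM.
    apply/nul_of_row_mx; exists 0, D; split=> //; first exact: graded0.
    by rewrite mulmx0 add0r.
  - exact: graded1.
  - apply/nul_row_mx; split; first exact: nM.
    apply/nul_of_row_mx; exists (U *m w), (D^T *m (1%:M - v *m w)); split=> //.
      exact: gradedMc.
    by rewrite addrC.
  - by rewrite subrr; apply: nul0.
  by rewrite subrr; apply: nul0.
have [_] := min _ _ _ _ _ gA i1; rewrite cardsC1 card_ord.
have := ltn_ord j0; lia.
Qed.

End Minimality.

(** * The complete decomposition *)

Section Assembly.

Variables (K : finFieldType) (d m r k : nat).
Variables (G : 'I_m -> deg d) (R : 'I_r -> deg d) (alpha : deg d).
Variables (M : 'M[K]_(m, r)) (N : 'M[K]_(m, k)) (B0 : {set block m r}).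
Hypotheses (gM : graded G R M) (bd : block_decomposed B0 M).
Hypothesis ci : forall b, b \in B0 -> corner_indec G R M b.
Hypothesis nz : forall b, b \in B0 -> ~ nul R M G (pr K b.1).
Hypothesis min : minimal G (addcols R alpha) (row_mx M N).
Hypothesis gN : graded G (fun=> alpha) N.
Implicit Types (b c : block m r) (B : {set block m r}).

Lemma coker_iso_eqv S k' (N' : 'M[K]_(m, k')) : eqv G R alpha M S N N' ->
  gmiso (coker G (addcols R alpha) (row_mx M N'))
        (coker G (addcols R alpha) (row_mx M N)).
Proof.
move=> [psi [T [T' [U [[[gpsi [P gP eP]] _ _ [psi' [[gpsi' [P' gP' eP']] e1 e2]]]]]]]].
move=> e3 e4 gU eN.
have gc k1 k2 (X : 'M[K]_(k1, k2)) :
    graded (fun _ : 'I_k1 => alpha) (fun _ : 'I_k2 => alpha) X.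
  by move=> i j; rewrite ledeg_refl.
apply: (coker_iso (F := psi') (F' := psi)) => //; rewrite ?mul_mx_row.
- apply/nul_row_mx; split; apply/nul_of_row_mx.
    by exists P', 0; split=> //; rewrite ?mulmx0 ?addr0 //; apply: graded0.
  exists (P' *m U), T; split=> //; first exact: gradedM gU.
  by rewrite eN mulmxDr !mulmxA e2 mul1mx eP' addrC.
- apply/nul_row_mx; split; apply/nul_of_row_mx.
    by exists P, 0; split=> //; rewrite ?mulmx0 ?addr0 //; apply: graded0.
  exists (- (U *m T')), T'; split=> //; first by apply: gradedN; apply: gradedMc.
  by rewrite eN mulmxDl -(mulmxA _ T) e3 mulmx1 mulmxN addrC mulmxA addrK.
- by rewrite e1 subrr; apply: nul0.
by rewrite e2 subrr; apply: nul0.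
Qed.

(** The corner condition leaves open that a block presents the zero module;
    minimality of the input excludes this. *)
Lemma complete_decomposition (res : result K m r) :
  eqv G R alpha M setT N (rN res) ->
  partial_decomp setT setT (rB res) (row_mx M (rN res)) ->
  (forall x, x \in rB res -> x.1 != set0 /\
    corner_indec G (@addcols d r R (rk res) alpha) (row_mx M (rN res)) x) ->
  [/\ graded G (addcols R alpha) (row_mx M (rN res)),
      gmiso (coker G (addcols R alpha) (row_mx M (rN res)))
            (coker G (addcols R alpha) (row_mx M N))
    & indec_decomposition G (addcols R alpha) (rB res) (row_mx M (rN res))].
Proof.
move=> eN pd ind; have iso := coker_iso_eqv eN.
have gA : graded G (addcols R alpha) (row_mx M (rN res)).
  apply/graded_row_mx; split=> //.
  have [psi [T [T' [U [[[gpsi _] _ _ _] _ _ gU ->]]]]] := eN.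
  apply: gradedD; last exact: gradedM gU.
  by apply: gradedMc; apply: gradedM gN.
split=> //; split; first exact: partial_decomp_setT.
move=> b bB; have cb := partial_decomp_cut pd bB; have [b0 cib] := ind b bB.
split; last exact: split_of_corner cib.
by move/(coker_submx_zeroP _ _ cb); apply: minimal_block_nonzero min gA iso cb b0.
Qed.

Lemma join_all : (join B0).1 = setT /\ (join B0).2 = setT.
Proof.
have [h1 h2 _] := bd; split; apply/setP => i; rewrite in_setT.
  by have [b [[bB ib] _]] := h1 i; apply/joinP1; exists b.
by have [b [[bB ib] _]] := h2 i; apply/joinP2; exists b.
Qed.

Lemma pB_all : pr K (join B0).1 = 1%:M.
Proof. by rewrite join_all.1 prT. Qed.

Lemma partial_decomp_blocks B : B \subset B0 ->
  partial_decomp (join B).1 (join B).2 B M.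
Proof.
move=> sB; split.
- by have /cutP := cut_join bd sB.
- by move=> b bB; split; apply: (bigcup_sup b).
- by split=> i; [move/joinP1 | move/joinP2].
- move=> b c bB cB; split=> i ib ic.
    exact: (row_block bd (subsetP sB b bB) (subsetP sB c cB) ib ic).
  exact: (col_block bd (subsetP sB b bB) (subsetP sB c cB) ib ic).
move=> i j iS nzij; have [_ _ /(_ i j nzij)[b [bB ib jb]]] := bd.
by exists b; split=> //; rewrite -(join_row bd sB bB ib).
Qed.

Lemma partial_decomp_widen B l (N' : 'M[K]_(m, l)) : B \subset B0 ->
  pr K (join B).1 *m N' = 0 ->
  partial_decomp (join B).1 (lshift l @: (join B).2) [set widen l b | b in B]
    (row_mx M N').
Proof.
move=> sB pN; have eM : colsub (@lshift r l) (row_mx M N') = M.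
  by apply/matrixP => i j; rewrite mxE row_mxEl.
apply: partial_decomp_recol; [exact: lshift_inj| |by rewrite eM; apply: partial_decomp_blocks].
move=> i j; case: (split_ordP j) => j' ->.
  rewrite row_mxEl mem_imset; last exact: lshift_inj.
  by have /cutP := cut_join bd sB; apply.
rewrite row_mxEr => nzij; apply/idP/imsetP => [iS|[x _ /eqP]]; last by rewrite eq_rlshift.
have := congr1 (fun X : 'M_(m, l) => X i j') pN.
by rewrite pr_mull iS mxE => z; rewrite z eqxx in nzij.
Qed.

Lemma widen_corner l (N' : 'M[K]_(m, l)) b : b \in B0 -> cut (row_mx M N') (widen l b) ->
  (widen l b).1 != set0 /\
  corner_indec G (@addcols d r R l alpha) (row_mx M N') (widen l b).
Proof.
move=> bB cb; split.
  by apply/eqP => /= b0; apply: (nz bB); rewrite b0 pr0; apply: nul0.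
apply: (corner_indec_recol (R1 := R)) => //; first exact: lshift_inj.
  by move=> j; rewrite /addcols (unsplitK (inl j)).
have -> : colsub (@lshift r l) (row_mx M N') = M.
  by apply/matrixP => i j; rewrite mxE row_mxEl.
exact: ci.
Qed.

End Assembly.

Theorem proposition5p11 (K : finFieldType) (d m r k : nat)
    (G : 'I_m -> deg d) (R : 'I_r -> deg d) (alpha : deg d)
    (B : {set block m r}) (M : 'M[K]_(m, r)) (N : 'M[K]_(m, k))
    (dec : forall l : nat, seq (splitmx K l)) :
  (forall l, is_dec (dec l)) ->
  alpha_decomposed G R alpha B M N ->
  (exists res, exhaustive_alpha_decomposition G R alpha M dec B N res) /\
  (forall res, exhaustive_alpha_decomposition G R alpha M dec B N res ->
    [/\ graded G (addcols R alpha) (row_mx M (rN res)),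
        gmiso (coker G (addcols R alpha) (row_mx M (rN res)))
              (coker G (addcols R alpha) (row_mx M N))
      & indec_decomposition G (addcols R alpha) (rB res)
          (row_mx M (rN res))]).
Proof.
move=> hdec [/graded_row_mx[gM gN] min [bd ind] ngeR].
have ci b : b \in B -> corner_indec G R M b.
  by move=> bB; apply: corner_of_indecomposable (ind b bB); apply: cut_block bB.
have nz b : b \in B -> ~ nul R M G (pr K b.1).
  move=> bB; have [h _] := ind b bB; move=> /(coker_submx_zeroP _ _ (cut_block bd bB)).
  exact: h.
have pB := pB_all bd; have sB : B \subset B by [].
have pN l (X : 'M[K]_(m, l)) : pr K (join B).1 *m X = X by rewrite pB mul1mx.
have iN : indep R alpha M N.
  move=> l C nC; apply/matrixP => i j.
  have : nul R M (fun=> alpha) (N *m col j C).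
    by rewrite colE mulmxA; apply: nul_mulc.
  by move/(minimal_indep gM gN min)/colP/(_ i); rewrite !mxE.
split.
  have [N' [Z red]] := reduce_all_exists G R alpha M B (enum B) N (0 : 'M_(m, 0)).
  have [u0|u0] := eqVneq (uncleared B N') set0.
    by eexists; apply: AD_finished red u0.
  have [res h] := exhaustive_exists G R alpha M hdec (uncleared B N') N'.
  by eexists; apply: AD_call red u0 h.
have pass s N' Z : perm_eq s (enum B) ->
    reduce_all G R alpha M B s N (0 : 'M_(m, 0)) N' Z ->
    [/\ eqv G R alpha M setT N N', graded G (fun=> alpha) N',
        pr K (join (uncleared B N')).1 *m N' = N', indep R alpha M N'
      & forall b, b \in uncleared B N' -> ~ clearable G R alpha M b N'].
  move=> ps red.
  have [|[psi [U [apsi gU e _]]] _ _ _ _] := reduce_allP bd sB _ red (pN _ _) (pN _ _).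
    by move=> c; rewrite (perm_mem ps) mem_enum.
  have [[gpsi _] _ _ _] := apsi.
  split.
  - exists psi, 1%:M, 1%:M, U; rewrite !mulmx1; split=> //.
    by rewrite -(join_all bd).1.
  - by rewrite e; apply: gradedD; [apply: gradedM gN | apply: gradedM gU].
  - exact: (pB_uncleared bd).
  - rewrite e -[psi *m N]mulmx1; apply: indep_eqv iN apsi gU _.
    exact: (mulmx1 1%:M).
  move=> b bU; exact: (uncleared_ncl bd sB ps red (pN _ _) (pN _ _) bU).
move=> res; case=> {res} [s N' Z ps red u0|s N' Z res ps red u0 h].
  have [eN gN' pN' iN' _] := pass s N' Z ps red.
  have N0 : N' = 0 by rewrite -pN' u0 /join /= !big_set0 pr0 mul0mx.
  have k0 : k = 0%N.
    apply/eqP; rewrite -leqn0 leqNgt; apply/negP => k0.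
    have : (1%:M : 'M[K]_k) = 0 by apply: iN'; rewrite N0 mul0mx; apply: nul0.
    by move/matrixP/(_ (Ordinal k0) (Ordinal k0))/eqP; rewrite !mxE eqxx oner_eq0.
  have pd : partial_decomp setT setT [set widen k b | b in B] (row_mx M N').
    have := @partial_decomp_widen _ _ _ _ _ bd B k N' sB.
    rewrite N0 mulmx0 => /(_ erefl); rewrite (join_all bd).1 (join_all bd).2.
    congr (partial_decomp _ _ _ _); apply/setP => j; rewrite in_setT.
    case: (split_ordP j) => j' ->; first by rewrite imset_f.
    by case: j' => i ik; exfalso; rewrite k0 in ik.
  apply: (complete_decomposition gM min gN) => //= x /imsetP[b bB ex].
  by rewrite ex; apply: (widen_corner alpha ci nz bB (partial_decomp_cut pd (imset_f _ bB))).
have [eN gN' pN' iN' ncl] := pass s N' Z ps red.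
have k0 : (0 < k)%N.
  rewrite lt0n; apply: contraNneq u0 => k0; apply/eqP/setP => b; rewrite !inE.
  apply/andP => -[_ /eqP[]]; apply/matrixP => i [j jk]; exfalso.
  by rewrite k0 in jk.
have sU := uncleared_sub B N'.
have adm : admissible G R alpha M B (uncleared B N') N' by split.
have [e1 q1 pd1 c1] := exhaustive_decomposes hdec gM bd ci nz ngeR h adm k0.
have sB2 : B :\: uncleared B N' \subset B by apply: subsetDl.
have z : pr K (join (B :\: uncleared B N')).1 *m rN res = 0.
  rewrite -q1 mulmxA (pB_disjoint bd sB2 sU) ?mul0mx //.
  by rewrite disjoints_subset; apply/subsetP => b; rewrite !inE => /andP[].
have pd2 := partial_decomp_widen bd sB2 z.
have BE : B = (B :\: uncleared B N') :|: uncleared B N'.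
  by rewrite setUC -{1}(setID B (uncleared B N')) (setIidPr sU).
have dis : [disjoint B :\: uncleared B N' & uncleared B N'].
  by rewrite disjoints_subset; apply/subsetP => b; rewrite !inE => /andP[].
have [disr disc] := join_disjoint bd sB2 sU dis.
have pd : partial_decomp setT setT
    ([set widen (rk res) b | b in B :\: uncleared B N'] :|: rB res) (row_mx M (rN res)).
  have [jr jc] := join_all bd.
  have := partial_decompU pd2 pd1 disr.
  rewrite -join_rowU -BE jr.
  have -> : lshift (rk res) @: (join (B :\: uncleared B N')).2 :|:
      cols (uncleared B N') (rk res) = setT.
    apply/setP => j; rewrite in_setU in_setT; case: (split_ordP j) => j' ->.
      rewrite mem_cols_lshift mem_imset; last exact: lshift_inj.
      have : j' \in (join B).2 by rewrite jc inE.
      move=> /joinP2[b bB jb]; apply/orP.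
      case: (boolP (b \in uncleared B N')) => bU; [right | left].
        by apply/joinP2; exists b.
      by apply/joinP2; exists b => //; rewrite inE bU.
    by rewrite mem_cols_rshift orbT.
  apply; rewrite disjoint_sym disjoints_subset; apply/subsetP => j jc'.
  rewrite inE; apply/imsetP => -[x xC ej]; rewrite ej mem_cols_lshift in jc'.
  by rewrite (disjointFr disc xC) in jc'.
apply: (complete_decomposition gM min gN) => //=.
  by apply: eqv_trans eN e1; apply: subsetT.
move=> x xD; have cx := partial_decomp_cut pd xD.
move: xD; rewrite inE => /orP[/imsetP[b bB ex]|xB]; last exact: c1.
by rewrite ex in cx *; apply: (widen_corner alpha ci nz (subsetP sB2 b bB) cx).
Qed.
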